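(* Let $m>1$. There is a constant $C(m)<\infty$, depending only on $m$, with $\sup_{1+\delta\le m\le\Delta}C(m)<\infty$ for all $\delta,\Delta>0$, such that the following holds. For every $n$ sufficiently large, let $G\sim\mathcal G(n,m/n)$ be a Bernoulli random graph, and let $V_n$ and $V_n'$ be vertices chosen independently and uniformly at random from the vertex set of $G$ (independently of $G$). Then, for every integer $u>-2r_n$, $$\Bigl|\mathbb P\bigl[D(V_n,V_n')>2r_n+u\bigr]-\mathbb E\Bigl(\exp\Bigl\{-\frac{m^{u+1}\,W\widetilde W}{(m-1)\chi_n^2}\Bigr\}\Bigr)\Bigr|\ \le\ C(m)\,m^{u/2}\max\{1,m^u\}\,n^{-1/2}\log n .$$
   Context: $\mathcal G(n,p)$ is the random graph on vertex set $[n]=\{1,\dots,n\}$ in which each of the $\binom n2$ possible edges is present independently with probability $p$. $D(v,v')$ is the graph distance between $v$ and $v'$ (equal to $0$ if $v=v'$ and to $\infty$ if there is no path joining them). Define $r_n:=\lfloor \tfrac12\log n/\log m\rfloor$ and $\chi_n:=m^{-r_n}\sqrt n$ (so that $1\le\chi_n\le m$). $W$ and $\widetilde W$ are independent copies of the almost sure limit $\lim_{r\to\infty}m^{-r}Z_r$, where $(Z_r,\,r\ge0)$ is a Bienaymé--Galton--Watson process with $Z_0=1$ and offspring distribution $\mathrm{Po}(m)$ (Poisson with mean $m$). *)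

(* Defs.v *)
From mathcomp Require Export all_boot all_order all_algebra.
From mathcomp Require Export all_classical all_reals all_analysis.
Export Order.TTheory GRing.Theory Num.Theory.
Export numFieldNormedType.Exports.

Set Implicit Arguments.
Unset Strict Implicit.
Unset Printing Implicit Defensive.

Local Open Scope classical_set_scope.
Local Open Scope ring_scope.

Definition vpairs (n : nat) : {set {set 'I_n}} := [set e : {set 'I_n} | #|e| == 2]%SET.

(* A simple graph on 'I_n is given by its edge set, a subset of [vpairs n]. *)
Definition adjacent (n : nat) (E : {set {set 'I_n}}) : rel 'I_n :=
  fun v w => (v != w) && ([set v; w]%SET \in E).

(* The infimum of the lengths of all walks from v to w; it is +oo when there is
   no such walk. *)
Definition gdist (R : realType) (n : nat) (E : {set {set 'I_n}})
    (v w : 'I_n) : \bar R :=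
  ereal_inf [set ((size s)%:R : R)%:E |
    s in [set s : seq 'I_n | path (adjacent E) v s /\ last v s = w]].

Definition gnp_pmf (R : realType) (n : nat) (p : R)
    (E : {set {set 'I_n}}) : R :=
  \prod_(e in vpairs n) (if e \in E then p else 1 - p).

(* P[A G V V'] for independent G ~ G(n,p) and V, V' uniform on 'I_n. *)
Definition gnp_prob (R : realType) (n : nat) (p : R)
    (A : {set {set 'I_n}} -> 'I_n -> 'I_n -> bool) : R :=
  \sum_(E : {set {set 'I_n}} | E \subset vpairs n)
    \sum_(v : 'I_n) \sum_(v' : 'I_n | A E v v')
      gnp_pmf p E * n%:R^-1 * n%:R^-1.

Definition mutually_independent (R : realType) (d d' : measure_display)
    (T : measurableType d) (T' : measurableType d') (P : probability T R)
    (I : eqType) (X : I -> {RV P >-> T'}) : Prop :=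
  forall (s : seq I) (A : I -> set T'), uniq s ->
    (forall i, measurable (A i)) ->
    P (\bigcap_(i in [set` s]) (X i @^-1` A i)) =
    (\prod_(i <- s) P (X i @^-1` A i))%E.

Definition independent_pair (R : realType) (d d' : measure_display)
    (T : measurableType d) (T' : measurableType d') (P : probability T R)
    (X Y : {RV P >-> T'}) : Prop :=
  forall A B : set T', measurable A -> measurable B ->
    P (X @^-1` A `&` Y @^-1` B) = (P (X @^-1` A) * P (Y @^-1` B))%E.

Definition poisson_iid (R : realType) (d : measure_display)
    (T : measurableType d) (P : probability T R) (m : R)
    (I : eqType) (X : I -> {RV P >-> nat}) : Prop :=
  mutually_independent X /\
  (forall i k, P (X i @^-1` [set k]) = (poisson_pmf m k)%:E).

(* xi (r, i) is the number of children of the i-th individual of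
   generation r. *)
Fixpoint bgw (T : Type) (xi : nat * nat -> T -> nat) (r : nat) (w : T) : nat :=
  if r is q.+1 then (\sum_(i < bgw xi q w) xi (q, val i) w)%N else 1%N.

Definition bgw_limit (R : realType) (d : measure_display)
    (T : measurableType d) (P : probability T R) (m : R)
    (xi : nat * nat -> {RV P >-> nat}) (W : {RV P >-> R}) : Prop :=
  {ae P, forall w, (fun r : nat => m ^- r * (bgw xi r w)%:R) @ \oo --> W w}.

Definition rn (R : realType) (m : R) (n : nat) : int :=
  Num.floor (2^-1 * ln n%:R / ln m).

Definition chi (R : realType) (m : R) (n : nat) : R :=
  m ^ (- rn m n) * Num.sqrt n%:R.

(* Main.v *)
(** Let S_k be the set of vertices at distance more than k from V_n. Exploring the graph
    from one vertex is the Reed-Frost chain, so P[D > k] = E|S_k| / n is an iterate of one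
    explicit Markov operator. Write k = j + b + 1 with j and b about k/2: after j steps from
    V_n, the event D > k says that the ball of radius b around V_n', explored in the
    remaining graph, sends no edge to the current frontier. On the level of the chain this
    is the symmetry of [nolink] in its two vertex sets, an identity between multinomial sums.
    Generating functions of the chain are then compared with those of the Poisson branching
    process by a recursion for the error, generating functions with the Laplace transform
    phi of W through phi(m t) = exp(-m (1 - phi t)), and everything is integrated against W.
    With M = m^b the total error is O(M / n + b M^3 / n^2); since M^2 <= n m^u, and b = O(log n)
    unless the bound is trivial, this is the claim. *)

Require Import Defs.
From mathcomp Require Import measurable_realfun ring lra zify.

Set Implicit Arguments.
Unset Strict Implicit.
Unset Printing Implicit Defensive.

Local Open Scope ring_scope.

(** * The exploration of the random graph *)

(** The splitting answers an obstacle of size. A ball of radius k contains a positive fraction of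
    the graph, where no branching approximation holds; one of radius k/2 has about [M = m^b]
    vertices with [M^2] at most of order [n m^u]. Even so, replacing such a ball by a tree fails
    with probability of order [M^2 / n], which does not tend to 0. What saves the estimate is that
    only generating functions are compared, at arguments [t = q^J] with [1 - t <= J m / n]. The
    defect [1 - s] stays proportional to [1 - t] along the recursion, so every error gains a factor
    of order [M / n], and [M^2 / n] becomes [M^3 / n^2].

    The branching process itself serves only to identify [phi] with the Laplace transform of W and
    to bound the second moment.

    The constants are powers of m and of [kap = m / (m - 1)], the sum of the geometric series in
    1/m. It is mostly used through [kap m = kap + m], and it is the only source of the blow-up of
    C(m) as m decreases to 1. *)

Section BernoulliSubset.
Import boot.fintype boot.finset.
Variables (R : realType) (T : finType).
Implicit Types (p : R) (F : {set T}) (g : {set T} -> R).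

(** Expectation over percolation on [F]. The ground set is a parameter, so that a graph can be
    revealed one batch of edges at a time. *)
Definition bexp p F g : R :=
  \sum_(E : {set T} | E \subset F)
    \prod_(e in F) (if e \in E then p else 1 - p) * g E.

Lemma bexp0 p g : bexp p set0 g = g set0.
Proof.
rewrite /bexp (big_pred1 set0) => [|E]; last by rewrite subset0.
by rewrite big1 ?mul1r // => e; rewrite inE.
Qed.

Lemma eq_bexp p F g g' :
  (forall E : {set T}, E \subset F -> g E = g' E) -> bexp p F g = bexp p F g'.
Proof. by move=> h; apply: eq_bigr => E /h ->. Qed.

Lemma bexpU1 p F x g : x \notin F ->
  bexp p (x |: F) g = (1 - p) * bexp p F g + p * bexp p F (fun E => g (x |: E)).
Proof.
move=> xF; rewrite /bexp (bigID (fun E : {set T} => x \in E)) /= addrC.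
have prodE (E : {set T}) : \prod_(e in x |: F) (if e \in E then p else 1 - p) =
    (if x \in E then p else 1 - p) * \prod_(e in F) (if e \in E then p else 1 - p).
  by rewrite big_setU1.
congr (_ + _).
- rewrite big_distrr /=; apply: eq_big => [E|E /andP[_ /negbTE xE]].
    apply/andP/idP => [[/subsetP EF xE]|EF].
      apply/subsetP => y yE; have := EF y yE; rewrite !inE => /orP[/eqP yx|//].
      by rewrite -yx yE in xE.
    split; first exact: subset_trans EF (subsetUr _ _).
    by apply: contra xF; exact: (subsetP EF).
  by rewrite prodE xE mulrA.
- rewrite big_distrr /= (reindex_onto (fun E => x |: E) (fun E => E :\ x)) /=; last first.
    by move=> E /andP[_ xE]; rewrite setD1K.
  apply: eq_big => [E|E /andP[/andP[EF _] /eqP Ex]].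
    rewrite setU11 andbT; apply/andP/idP => [[EF /eqP <-]|EF].
      by rewrite subDset.
    split; first exact: setUS.
    rewrite setU1K //; apply: contra xF; exact: (subsetP EF).
  rewrite prodE setU11 -mulrA; congr (_ * (_ * _)).
  apply: eq_bigr => e eF; rewrite !inE; case: eqVneq => // ex.
  by rewrite -ex eF in xF.
Qed.

Lemma bexp_cst p F c : bexp p F (fun=> c) = c.
Proof.
have [k] := ubnP #|F|; elim: k F => // k IH F.
have [->|/set0Pn[x xF]] := eqVneq F set0; first by rewrite bexp0.
rewrite (cardsD1 x) xF ltnS => /IH h.
by rewrite -(setD1K xF) bexpU1 ?setD11// h -mulrDl subrK mul1r.
Qed.

(** Disjoint batches of edges are independent; every conditioning argument below rests on this. *)
Lemma bexpU p F1 F2 g : [disjoint F1 & F2] ->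
  bexp p (F1 :|: F2) g =
  bexp p F1 (fun E1 => bexp p F2 (fun E2 => g (E1 :|: E2))).
Proof.
have [k] := ubnP #|F1|; elim: k F1 g => // k IH F1 g.
have [->|/set0Pn[x xF]] := eqVneq F1 set0.
  by move=> _ _; rewrite bexp0 set0U; apply: eq_bexp => E _; rewrite set0U.
rewrite (cardsD1 x) xF ltnS => hk dis.
have dis' : [disjoint F1 :\ x & F2] by apply: disjointWl dis; exact: subD1set.
have xF2 : x \notin F2 by apply/negP => xF2; rewrite (disjointFr dis xF) in xF2.
rewrite -{1 2}(setD1K xF) -setUA bexpU1; last first.
  by rewrite !inE eqxx (negbTE xF2).
rewrite !IH // bexpU1 ?setD11 //; congr (_ + _ * _).
by apply: eq_bexp => E1 _; apply: eq_bexp => E2 _; rewrite setUA.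
Qed.

End BernoulliSubset.

Section Binomial.
Variable R : realType.
Implicit Types (p : R) (g : nat -> R).

Definition binexp S p g : R :=
  \sum_(N < S.+1) 'C(S, N)%:R * p ^+ N * (1 - p) ^+ (S - N) * g N.

Lemma binexp0 p g : binexp 0 p g = g 0%N.
Proof. by rewrite /binexp big_ord1 /= bin0 !expr0 !mul1r. Qed.

Lemma binexpS S p g :
  binexp S.+1 p g = (1 - p) * binexp S p g + p * binexp S p (fun N => g N.+1).
Proof.
pose t S N : R := 'C(S, N)%:R * p ^+ N * (1 - p) ^+ (S - N).
rewrite /binexp -/t big_ord_recl /= bin0 expr0 subn0.
under eq_bigr => i _ do rewrite /bump leq0n add1n binS natrD !mulrDl subSS.
rewrite big_split /= addrA; congr (_ + _).
- rewrite big_ord_recr /= bin_small // !mul0r addr0 [in RHS]big_ord_recl.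
  rewrite mulrDr bin0 subn0 expr0 exprS !mulrA; congr (_ + _).
    by rewrite !(mul1r, mulr1).
  rewrite mulr_sumr; apply: eq_bigr => i _; rewrite !lift0.
  by rewrite -[(S - i)%N]subnSK // [(1 - p) ^+ _.+1]exprS; ring.
- by rewrite mulr_sumr; apply: eq_bigr => i _; rewrite exprS; ring.
Qed.

Lemma bexp_card (T : finType) p (F : {set T}) g :
  bexp p F (fun E => g #|E|) = binexp #|F| p g.
Proof.
have [k] := ubnP #|F|; elim: k F g => // k IH F g.
have [->|/set0Pn[x xF]] := eqVneq F (finset.set0).
  by rewrite bexp0 cards0 binexp0.
rewrite (cardsD1 x) xF ltnS add1n => hk.
rewrite -{1}(finset.setD1K xF) bexpU1 ?finset.setD11// binexpS -!IH //.
congr (_ + _ * _); apply: eq_bexp => E EF; rewrite cardsU1.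
by rewrite (contra (fintype.subsetP EF x)) // finset.setD11.
Qed.

End Binomial.

(** * Breadth-first exploration of a fixed graph *)

Section Exploration.
Import boot.fintype boot.finset.
Variable n : nat.
Implicit Types (S A : {set 'I_n}) (E : {set {set 'I_n}}).

Definition frontier S A E : {set 'I_n} :=
  [set w in S | [exists a in A, [set a; w] \in E]].

Fixpoint unreached k S A E : {set 'I_n} :=
  if k is k'.+1 then unreached k' (S :\: frontier S A E) (frontier S A E) E
  else S.

Lemma frontier_sub S A E : frontier S A E \subset S.
Proof. by apply/subsetP => w; rewrite inE => /andP[]. Qed.

(** The second hypothesis is the invariant of the exploration: vertices discarded earlier have no
    edge into [S], so a walk can enter [S] only from [A]. Walks may start anywhere outside [S], not
    just in [A], because this form survives the passage from [S] to [S] minus its frontier. *)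
Lemma unreachedP k S A E w : [disjoint S & A] ->
  (forall c s, c \notin S -> s \in S -> [set c; s] \in E -> c \in A) ->
  reflect (forall c s, c \notin S -> path (adjacent E) c s -> last c s = w ->
             (k < size s)%N)
    (w \in unreached k S A E).
Proof.
elim: k S A => [|k IH] S A dSA inv /=.
  apply: (iffP idP) => [wS c [|//] cS _ /= cw|h].
    by rewrite cw wS in cS.
  by apply/negPn/negP => wS; have := h w [::] wS isT erefl.
set N := frontier S A E.
have NE c s : c \notin S -> s \in S -> [set c; s] \in E -> s \in N.
  move=> cS sS cs; rewrite inE sS; apply/existsP; exists c.
  by rewrite (inv c s).
have dN : [disjoint S :\: N & N] by rewrite -setI_eq0 setIDAC setDIl setDv setI0.
apply: (iffP (IH _ _ dN _)) => [c s|h c s cS|h c s].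
- rewrite !in_setD negb_and negbK => /orP[//|cS] /andP[sN sS] cs.
  by have := NE c s cS sS cs; rewrite (negbTE sN).
(* After its first edge the walk is still outside [S :\: N]: a neighbour lying in [S] is in the
   frontier. *)
- case: s => [|x s] /= hp hl.
    have := h c [::]; rewrite in_setD (negbTE cS) andbF => /(_ isT isT hl).
    by [].
  case/andP: hp => /andP[cx xE] hp; rewrite ltnS; apply: (h x) => //.
  rewrite in_setD negb_and negbK; case xS : (x \in S); last by rewrite orbT.
  by rewrite (NE c).
- rewrite in_setD negb_and negbK => /orP[cN|cS] hp hl; last first.
    exact: ltnW (h c s cS hp hl).
  move: (cN); rewrite inE => /andP[cS /existsP[a /andP[aA ac]]].
  (* A walk starting in the frontier is prolonged backwards by one edge to a vertex of [A], outside
     [S]. *)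
  have aS : a \notin S by apply/negP => aS; rewrite (disjointFr dSA aS) in aA.
  apply: (h a (c :: s)) => //=; rewrite hp andbT /adjacent ac andbT.
  by apply: contraNneq aS => ->.
Qed.

End Exploration.

Section ReedFrost.
Variable R : realType.
Implicit Types (q : R) (g : nat -> nat -> nat -> R).

(* One step of the Reed-Frost chain: [a] removed, [S] susceptible and [J]
   infective vertices. *)
Definition rf_step q g (a S J : nat) : R :=
  binexp S (1 - q ^+ J) (fun N => g (a + J)%N (S - N)%N N).

End ReedFrost.

Section ExplorationLaw.
Import boot.fintype boot.finset.
Variables (R : realType) (n : nat) (p : R).
Implicit Types (S A : {set 'I_n}) (E : {set {set 'I_n}}).

Definition star S A : {set {set 'I_n}} := [set [set a; w] | w in S, a in A].

Lemma starP S A e :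
  reflect (exists w a, [/\ w \in S, a \in A & e = [set a; w]]) (e \in star S A).
Proof.
apply: (iffP imset2P) => [[w a wS aA ->]|[w [a [wS aA ->]]]].
  by exists w, a.
by exists w a.
Qed.

Lemma star_vpairs S A : [disjoint S & A] -> star S A \subset vpairs n.
Proof.
move=> d; apply/subsetP => e /starP[w [a [wS aA ->]]].
rewrite inE cards2; suff -> : a != w by [].
by apply: contraTneq aA => ->; rewrite (disjointFr d wS).
Qed.

Lemma pair_starE S A x y : [disjoint S & A] -> x \notin A -> y \notin A ->
  ([set x; y] \in star S A) = false.
Proof.
move=> d xA yA; apply/negP => /starP[w [a [wS aA /setP/(_ a)]]].
by rewrite !inE eqxx /= => /orP[] /eqP aE; rewrite aE ?(negbTE xA) ?(negbTE yA) in aA.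
Qed.

Lemma bexp_empty (T : finType) (F : {set T}) (h : bool -> R) :
  bexp p F (fun E : {set T} => h (E == set0)) =
  (1 - p) ^+ #|F| * h true + (1 - (1 - p) ^+ #|F|) * h false.
Proof.
have [k] := ubnP #|F|; elim: k F => // k IH F.
have [->|/set0Pn[x xF]] := eqVneq F set0.
  by rewrite bexp0 cards0 expr0 eqxx subrr mul0r addr0 mul1r.
rewrite (cardsD1 x) xF ltnS add1n => hk.
rewrite -{1}(setD1K xF) bexpU1 ?setD11// IH// exprS.
rewrite (_ : bexp _ _ (fun E : {set T} => h (x |: E == set0)) = h false); first by ring.
rewrite -[RHS](bexp_cst p (F :\ x)); apply: eq_bexp => E _; congr h.
by apply/negbTE/set0Pn; exists x; rewrite setU11.
Qed.

Lemma card_star1 w A : w \notin A -> #|star [set w] A| = #|A|.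
Proof.
move=> wA; have -> : star [set w] A = [set [set a; w] | a in A].
  apply/setP => e; apply/starP/imsetP => [[x [a [/set1P -> aA ->]]]|[a aA ->]].
    by exists a.
  by exists w, a; rewrite set11.
rewrite card_in_imset // => a b aA bA /setP/(_ a).
rewrite !inE eqxx /= => /esym/orP[/eqP//|/eqP aw].
by rewrite -aw aA in wA.
Qed.

Lemma frontierU1 w S A E1 E2 : w \notin S -> [disjoint w |: S & A] ->
  E1 \subset star [set w] A -> E2 \subset star S A ->
  frontier (w |: S) A (E1 :|: E2) =
  if E1 == set0 then frontier S A E2 else w |: frontier S A E2.
Proof.
move=> wS d s1 s2.
have wA : w \notin A by rewrite (disjointFr d (setU11 _ _)).
have dS : [disjoint S & A] by apply: disjointWl d; exact: subsetUr.
have in1 x a : a \in A -> x != w -> x \notin A -> [set a; x] \notin E1.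
  move=> aA xw xA; apply/negP => /(subsetP s1)/starP[y [b [/set1P -> bA /setP/(_ x)]]].
  rewrite !inE eqxx orbT (negbTE xw) orbF => /esym/eqP xb.
  by rewrite xb bA in xA.
have in2 a : a \in A -> [set a; w] \notin E2.
  move=> aA; apply/negP => /(subsetP s2)/starP[y [b [yS bA /setP/(_ w)]]].
  rewrite !inE eqxx orbT => /esym/orP[] /eqP wE.
    by rewrite wE bA in wA.
  by rewrite wE yS in wS.
have fS : w \notin frontier S A E2 by rewrite inE (negbTE wS).
have memw : (w \in frontier (w |: S) A (E1 :|: E2)) = (E1 != set0).
  rewrite inE setU11 /=; apply/existsP/set0Pn => [[a /andP[aA]]|[e eE]].
    by rewrite inE (negbTE (in2 a aA)) orbF => h; exists [set a; w].
  have /starP[y [a [/set1P yw aA eaw]]] := subsetP s1 e eE; exists a.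
  by rewrite aA inE -yw -eaw eE.
have memx x : x != w ->
    (x \in frontier (w |: S) A (E1 :|: E2)) = (x \in frontier S A E2).
  move=> xw; rewrite !inE (negbTE xw) /=; case xS : (x \in S) => //=.
  apply/eq_existsb => a; case aA : (a \in A) => //=.
  by rewrite inE (negbTE (in1 x a _ _ _)) // (disjointFr dS xS).
apply/setP => x; have [->|xw] := eqVneq x w.
  by rewrite memw; case: eqVneq => _; rewrite ?(negbTE fS) // setU11.
by rewrite memx //; case: eqVneq => // _; rewrite !in_setU1 (negbTE xw).
Qed.

(** A vertex of [S] is in the frontier unless all its [#|A|] edges to [A] are absent, and the edge
    sets of distinct vertices are disjoint. The induction peels off one vertex [w] with its own
    star. *)
Lemma frontier_law S A (g : {set 'I_n} -> R) : [disjoint S & A] ->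
  bexp p (star S A) (fun E => g (frontier S A E)) =
  bexp (1 - (1 - p) ^+ #|A|) S g.
Proof.
have [k] := ubnP #|S|; elim: k S g => // k IH S g.
have [->|/set0Pn[w wS]] := eqVneq S set0.
  move=> _ _; have -> : star set0 A = set0.
    by apply/setP => e; rewrite inE; apply/negP => /starP[w [a []]]; rewrite inE.
  rewrite !bexp0; congr g; apply/setP => x; by rewrite !inE.
rewrite (cardsD1 w) wS ltnS => hk; rewrite -(setD1K wS).
set S' := S :\ w => d; have wS' : w \notin S' by rewrite setD11.
have wA : w \notin A by rewrite (disjointFr d (setU11 _ _)).
have d' : [disjoint S' & A] by apply: disjointWl d; exact: subsetUr.
have -> : star (w |: S') A = star [set w] A :|: star S' A.
  apply/setP => e; rewrite inE; apply/starP/orP => [[x [a [/setU1P[->|xS] aA ->]]]|].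
  - by left; apply/starP; exists w, a; rewrite set11.
  - by right; apply/starP; exists x, a.
  - by case=> /starP[x [a [xS aA ->]]]; exists x, a; split => //;
      rewrite in_setU1 ?(set1P xS) ?eqxx ?xS ?orbT.
rewrite bexpU; last first.
  rewrite -setI_eq0; apply/eqP/setP => e; rewrite !inE; apply/negP.
  case/andP => /starP[x [a [/set1P -> aA ->]]] /starP[y [b [yS bA /setP/(_ w)]]].
  rewrite !inE eqxx orbT => /esym/orP[] /eqP wE.
    by rewrite wE bA in wA.
  by rewrite wE yS in wS'.
rewrite bexpU1 // -!IH //.
pose h b := bexp p (star S' A) (fun E => g (if b then frontier S' A E else w |: frontier S' A E)).
transitivity (bexp p (star [set w] A) (fun E1 => h (E1 == set0))).
  apply: eq_bexp => E1 s1; apply: eq_bexp => E2 s2.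
  by rewrite (frontierU1 wS' d s1 s2).
by rewrite bexp_empty card_star1 //; congr (_ * _ + _ * _); ring.
Qed.

Lemma eq_unreached k S A E E' :
  (forall x y, x \in S :|: A -> y \in S :|: A ->
     ([set x; y] \in E) = ([set x; y] \in E')) ->
  unreached k S A E = unreached k S A E'.
Proof.
elim: k S A => //= k IH S A h.
have -> : frontier S A E = frontier S A E'.
  apply/setP => w; rewrite !inE; case wS : (w \in S) => //=.
  apply/eq_existsb => a; case aA : (a \in A) => //=.
  by rewrite h // inE ?wS ?aA ?orbT.
apply: IH => x y; have Fs := subsetP (frontier_sub S A E').
by rewrite !inE => /orP[/andP[_ xS]|/andP[xS _]] /orP[/andP[_ yS]|/andP[yS _]];
   apply: h; rewrite inE ?xS ?yS.
Qed.

(** Markov property: the first step reads only edges between [S] and [A], the later steps only edges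
    inside [S]. The count [a] is arbitrary because the final functional ignores it. *)
Lemma unreached_law k S A a : [disjoint S & A] ->
  bexp p (vpairs n) (fun E => #|unreached k S A E|%:R) =
  iter k (rf_step (1 - p)) (fun _ s _ => s%:R) a #|S| #|A|.
Proof.
elim: k S A a => [|k IH] S A a d; first by rewrite /= bexp_cst.
pose V := vpairs n; pose F := star S A.
have VE : V = F :|: (V :\: F).
  by rewrite -{1}(setID V F) (setIidPr _) // star_vpairs.
have dF : [disjoint F & V :\: F] by rewrite -setI_eq0 setIDA setDIl setDv set0I.
have sub2 (N : {set _}) E1 E2 : N \subset S -> E1 \subset F ->
    unreached k (S :\: N) N (E1 :|: E2) = unreached k (S :\: N) N E2.
  move=> NS s1; apply: eq_unreached => x y.
  have -> : S :\: N :|: N = S by rewrite -{2}(setID S N) setUC (setIidPr NS).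
  move=> xS yS; rewrite inE; case: (boolP (_ \in E1)) => // /(subsetP s1).
  by rewrite pair_starE // (disjointFr d).
(* Restoring the edges already revealed does not change the law of the rest, so the remaining steps
   can be run on a fresh full graph, to which the induction hypothesis applies. *)
have indep (N : {set _}) : N \subset S ->
    bexp p V (fun E => #|unreached k (S :\: N) N E|%:R) =
    bexp p (V :\: F) (fun E => #|unreached k (S :\: N) N E|%:R) :> R.
  move=> NS; rewrite VE bexpU //.
  transitivity (bexp p F (fun=>
    bexp p (V :\: F) (fun E => #|unreached k (S :\: N) N E|%:R : R))).
    by apply: eq_bexp => E1 s1; apply: eq_bexp => E2 _; rewrite sub2.
  by rewrite bexp_cst -VE.
rewrite -/V VE bexpU //.
transitivity (bexp p F (fun E1 =>
    bexp p V (fun E => #|unreached k (S :\: frontier S A E1) (frontier S A E1) E|%:R : R))).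
  apply: eq_bexp => E1 s1; rewrite indep ?frontier_sub //.
  apply: eq_bexp => E2 s2 /=.
  have -> : frontier S A (E1 :|: E2) = frontier S A E1.
    apply/setP => w; rewrite !inE; case wS : (w \in S) => //=.
    apply/eq_existsb => b; case bA : (b \in A) => //=.
    rewrite inE; case e2 : (_ \in E2); last by rewrite orbF.
    move/(subsetP s2): e2; rewrite inE => /andP[/negP[]].
    by apply/starP; exists w, b.
  by rewrite sub2 ?frontier_sub.
rewrite (frontier_law
  (fun N => bexp p V (fun E => #|unreached k (S :\: N) N E|%:R)) d) /=.
rewrite /rf_step -bexp_card; apply: eq_bexp => N NS.
rewrite (IH _ _ (a + #|A|)%N); first by rewrite cardsD (setIidPr NS).
by rewrite -setI_eq0 setIDAC setDIl setDv setI0.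
Qed.

Lemma lt_gdistP (k : nat) E v w :
  (k%:R%:E < gdist R E v w)%E = (w \in unreached k [set~ v] [set v] E).
Proof.
have d : [disjoint [set~ v] & [set v]].
  by rewrite -setI_eq0 setIC setICr.
have inv c s : c \notin [set~ v] -> s \in [set~ v] -> [set c; s] \in E -> c \in [set v].
  by rewrite !inE negbK.
apply/idP/(unreachedP k w d inv) => [h c s|h].
  rewrite !inE negbK => /eqP -> hp hl.
  have : (gdist R E v w <= (size s)%:R%:E)%E by apply: ereal_inf_lbound; exists s.
  by move/(lt_le_trans h); rewrite lte_fin ltr_nat.
(* Lengths are integers, so the infimum is at least [k.+1], which keeps the inequality strict; the
   case of no walk at all is included. *)
apply: (@lt_le_trans _ _ k.+1%:R%:E); first by rewrite lte_fin ltr_nat.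
apply/ereal_infP => _ [s [hp hl] <-]; rewrite lee_fin ler_nat.
by apply: (h v) => //; rewrite !inE eqxx.
Qed.

Lemma gnp_prob_gdist k : (0 < n)%N ->
  gnp_prob p (fun E v w => (k%:R%:E < gdist R E v w)%E) =
  n%:R^-1 * iter k (rf_step (1 - p)) (fun _ s _ => s%:R) 0%N n.-1 1%N.
Proof.
move=> n0; rewrite /gnp_prob exchange_big /=.
(* Every starting vertex contributes the same; summing over the second vertex counts the unreached
   ones. *)
transitivity (\sum_(v : 'I_n) n%:R^-1 * n%:R^-1 *
    iter k (rf_step (1 - p)) (fun _ s _ => s%:R) 0%N n.-1 1%N).
  apply: eq_bigr => v _.
  have d : [disjoint [set~ v] & [set v]].
    by rewrite -setI_eq0 setIC setICr.
  have := unreached_law k 0 d; rewrite cardsC1 cards1 card_ord => <-.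
  rewrite mulr_sumr; apply: eq_bigr => E _.
  rewrite (eq_bigl (fun w => w \in unreached k [set~ v] [set v] E)); last first.
    by move=> w; rewrite lt_gdistP.
  by rewrite sumr_const -[in RHS]mulrA -mulr_natr /gnp_pmf; ring.
rewrite sumr_const card_ord -[_ *+ n]mulr_natr.
by field; rewrite pnatr_eq0 -lt0n.
Qed.

End ExplorationLaw.

(** * The Reed-Frost chain *)

Section Elementary.
Variable R : realType.
Implicit Types x y p : R.

Lemma expRN_ge x : 1 - x <= expR (- x).
Proof. exact: expR_ge1Dx. Qed.

(** From [expR x >= 1 + x], because (1 - x + x^2)(1 + x) = 1 + x^3. *)
Lemma expRN_le x : 0 <= x -> expR (- x) <= 1 - x + x ^+ 2.
Proof.
move=> x0; rewrite expRN -div1r ler_pdivrMr ?expR_gt0 //.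
have q0 : 0 <= 1 - x + x ^+ 2 by nra.
apply: le_trans (ler_wpM2l q0 (expR_ge1Dx x)).
by have : 0 <= x ^+ 3 by [exact: exprn_ge0]; nra.
Qed.

Lemma expR_lip x y : x <= 0 -> y <= 0 -> `|expR x - expR y| <= `|x - y|.
Proof.
wlog xy : x y / x <= y => [h x0 y0|x0 y0].
  by case/orP: (le_total x y) => le; [|rewrite distrC [leRHS]distrC]; exact: h.
rewrite distrC [leRHS]distrC !ger0_norm ?subr_ge0 ?ler_expR //.
have -> : expR x = expR (x - y) * expR y by rewrite -expRD subrK.
have e1 := expR_ge1Dx (x - y); have e2 : expR y <= 1 by rewrite expR_le1.
have e4 : expR (x - y) <= 1 by rewrite expR_le1 subr_le0.
have : 0 <= (1 - expR y) * (1 - expR (x - y)) by rewrite mulr_ge0 // subr_ge0.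
by move: e1; set A := expR (x - y); set B := expR y; lra.
Qed.

Lemma pow_lip k x y : 0 <= x <= 1 -> 0 <= y <= 1 ->
  `|x ^+ k - y ^+ k| <= k%:R * `|x - y|.
Proof.
move=> /andP[x0 x1] /andP[y0 y1]; elim: k => [|k IH].
  by rewrite !expr0 subrr normr0 mul0r.
have -> : x ^+ k.+1 - y ^+ k.+1 = x * (x ^+ k - y ^+ k) + (x - y) * y ^+ k.
  by rewrite !exprS; ring.
rewrite (le_trans (ler_normD _ _)) // !normrM -natr1 mulrDl mul1r lerD //.
  by rewrite (le_trans _ IH) // (ger0_norm x0) ler_piMl.
by rewrite ler_piMr // ger0_norm ?exprn_ge0 // exprn_ile1.
Qed.

Lemma pow_onem_ge k p : 0 <= p <= 1 -> 1 - k%:R * p <= (1 - p) ^+ k.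
Proof.
move=> /andP[p0 p1]; elim: k => [|k IH]; first by rewrite expr0 mul0r subr0.
rewrite exprS -natr1; have : (0 : R) <= k%:R by [].
have q0 : 0 <= 1 - p by lra.
by move=> k0; apply: le_trans (ler_wpM2l q0 IH); nra.
Qed.

Lemma pow_onem_le k p : 0 <= p <= 1 ->
  (1 - p) ^+ k <= 1 - k%:R * p + (k%:R * p) ^+ 2.
Proof.
move=> /andP[p0 p1]; have q0 : 0 <= 1 - p by lra.
elim: k => [|k IH]; first by rewrite expr0 mul0r subr0 expr0n addr0.
rewrite exprS -natr1; have k0 : (0 : R) <= k%:R by [].
apply: le_trans (ler_wpM2l q0 IH) _; set K := k%:R in k0 *.
have h1 : 0 <= p ^+ 2 by exact: sqr_ge0.
have h2 : 0 <= K * p ^+ 2 by exact: mulr_ge0.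
have h3 : 0 <= K ^+ 2 * p ^+ 3 by rewrite mulr_ge0 // ?sqr_ge0 // exprn_ge0.
rewrite -subr_ge0 (_ : _ - _ = K * p ^+ 2 + K ^+ 2 * p ^+ 3 + p ^+ 2); last ring.
by rewrite !addr_ge0.
Qed.

End Elementary.

Section BinomialExpectation.
Variable R : realType.
Implicit Types (p : R) (g : nat -> R).

Lemma binexp_pow S p (s : R) : binexp S p (fun N => s ^+ N) = (1 - p + p * s) ^+ S.
Proof.
elim: S => [|S IH]; first by rewrite binexp0 !expr0.
rewrite binexpS IH exprS [RHS]mulrDl; congr (_ + _).
by rewrite -IH /binexp !mulr_sumr; apply: eq_bigr => N _; rewrite exprS; ring.
Qed.

Lemma binexp_quad S p (c0 c1 c2 : R) :
  binexp S p (fun N => c0 + c1 * N%:R + c2 * N%:R ^+ 2) =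
  c0 + c1 * (S%:R * p) + c2 * ((S%:R * p) ^+ 2 + S%:R * p * (1 - p)).
Proof.
elim: S c0 c1 c2 => [|S IH] c0 c1 c2; first by rewrite binexp0; ring.
rewrite binexpS IH.
have -> : (fun N : nat => c0 + c1 * N.+1%:R + c2 * N.+1%:R ^+ 2) =
    (fun N : nat => (c0 + c1 + c2) + (c1 + 2 * c2) * N%:R + c2 * N%:R ^+ 2).
  by apply/funext => N; rewrite -natr1; ring.
by rewrite IH -natr1; ring.
Qed.

End BinomialExpectation.

Section ChainRepresentation.
Variables (R : realType) (q : R).
Hypothesis q01 : 0 <= q <= 1.
Implicit Types g h : nat -> nat -> nat -> R.

Let pi01 J : 0 <= 1 - q ^+ J <= 1.
Proof.
by case/andP: q01 => q0 q1; rewrite subr_ge0 exprn_ile1 // lerBlDr lerDl exprn_ge0.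
Qed.

(** One entry per trajectory, with its weight and final state. The list does not depend on [g],
    which makes monotonicity, linearity and the exchange of two chains statements about finite sums.
    The recorded invariants, [S] nonincreasing and [a + J + S] conserved, are what later comparisons
    may assume about a reachable state. *)
Lemma rf_repr k a S J : exists r : seq (R * (nat * nat * nat)),
  (forall x, x \in r ->
    [/\ 0 <= x.1, (x.2.1.2 <= S)%N & (x.2.1.1 + x.2.2 + x.2.1.2 = a + J + S)%N]) /\
  forall g, iter k (rf_step q) g a S J =
    \sum_(x <- r) x.1 * g x.2.1.1 x.2.1.2 x.2.2.
Proof.
elim: k => [|k [r [rP rE]]].
  exists [:: (1, (a, S, J))]; split=> [x|g]; last by rewrite big_seq1 mul1r.
  by rewrite inE => /eqP -> /=.
pose w (x : R * (nat * nat * nat)) (N : nat) : R :=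
  'C(x.2.1.2, N)%:R * (1 - q ^+ x.2.2) ^+ N *
  (1 - (1 - q ^+ x.2.2)) ^+ (x.2.1.2 - N).
exists [seq (x.1 * w x N, ((x.2.1.1 + x.2.2)%N, (x.2.1.2 - N)%N, N)) |
  x <- r, N <- iota 0 x.2.1.2.+1]; split=> [y|g].
  case/allpairsPdep => x [N [/rP[x0 xS xs]]]; rewrite mem_iota ltnS => /andP[_ NS] ->.
  case/andP: (pi01 x.2.2) => p0 p1; split => /=.
  - by rewrite !mulr_ge0 // exprn_ge0 // subr_ge0.
  - by rewrite (leq_trans (leq_subr _ _)).
  - by rewrite -addnA subnKC // xs.
rewrite iterSr rE big_allpairs_dep /=; apply: eq_bigr => x _.
rewrite /rf_step /binexp mulr_sumr -(big_mkord xpredT (fun N =>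
  x.1 * ('C(x.2.1.2, N)%:R * (1 - q ^+ x.2.2) ^+ N *
  (1 - (1 - q ^+ x.2.2)) ^+ (x.2.1.2 - N) *
  g (x.2.1.1 + x.2.2)%N (x.2.1.2 - N)%N N))).
by rewrite /index_iota subn0; apply: eq_bigr => N _; rewrite mulrA.
Qed.

Lemma ler_rf k g h a S J :
  (forall a' S' J', (S' <= S)%N -> (a' + J' + S' = a + J + S)%N ->
     g a' S' J' <= h a' S' J') ->
  iter k (rf_step q) g a S J <= iter k (rf_step q) h a S J.
Proof.
move=> gh; have [r [rP rE]] := rf_repr k a S J; rewrite !rE big_seq [leRHS]big_seq.
by apply: ler_sum => x /rP[x0 xS xs]; apply: ler_wpM2l => //; exact: gh.
Qed.

Lemma rfD k g h a S J :
  iter k (rf_step q) (fun a S J => g a S J + h a S J) a S J =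
  iter k (rf_step q) g a S J + iter k (rf_step q) h a S J.
Proof.
have [r [_ rE]] := rf_repr k a S J; rewrite !rE -big_split /=.
by apply: eq_bigr => x _; rewrite mulrDr.
Qed.

Lemma rfZ k c g a S J :
  iter k (rf_step q) (fun a S J => c * g a S J) a S J =
  c * iter k (rf_step q) g a S J.
Proof.
have [r [_ rE]] := rf_repr k a S J; rewrite !rE mulr_sumr.
by apply: eq_bigr => x _; rewrite mulrCA.
Qed.

Lemma rf_cst k c a S J : iter k (rf_step q) (fun _ _ _ => c) a S J = c.
Proof.
elim: k a S J => //= k IH a S J; rewrite /rf_step.
under eq_fun do rewrite IH.
have := binexp_quad S (1 - q ^+ J) c 0 0.
rewrite (_ : (fun N => _) = fun=> c); first by move=> ->; ring.
by apply/funext => N; ring.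
Qed.

Lemma rf_dist k g h e a S J :
  (forall a' S' J', (S' <= S)%N -> (a' + J' + S' = a + J + S)%N ->
     `|g a' S' J' - h a' S' J'| <= e a' S' J') ->
  `|iter k (rf_step q) g a S J - iter k (rf_step q) h a S J|
     <= iter k (rf_step q) e a S J.
Proof.
move=> gh; have [r [rP rE]] := rf_repr k a S J; rewrite !rE -sumrB.
rewrite (le_trans (ler_norm_sum _ _ _)) // big_seq [leRHS]big_seq.
apply: ler_sum => x /rP[x0 xS xs]; rewrite -mulrBr normrM ger0_norm //.
by apply: ler_wpM2l => //; exact: gh.
Qed.

(** Fubini for two independent chains. *)
Lemma rf_exchange k l (h : nat -> nat -> nat -> nat -> nat -> nat -> R)
    a S J a' S' J' :
  iter k (rf_step q) (fun b T K => iter l (rf_step q) (h b T K) a' S' J') a S J =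
  iter l (rf_step q) (fun b' T' K' =>
    iter k (rf_step q) (fun b T K => h b T K b' T' K') a S J) a' S' J'.
Proof.
have [r [_ rE]] := rf_repr k a S J; have [r' [_ rE']] := rf_repr l a' S' J'.
rewrite rE rE'; under eq_bigr do rewrite rE' mulr_sumr.
under [RHS]eq_bigr do rewrite rE mulr_sumr.
rewrite exchange_big /=; apply: eq_bigr => x _; apply: eq_bigr => y _.
by rewrite mulrCA.
Qed.

End ChainRepresentation.

(** * Symmetry between the two explored sets *)

Section Duality.
Variables (R : realType).
Implicit Types (p q x y : R).

Lemma eq_binexp S p g g' :
  (forall N, (N <= S)%N -> g N = g' N) -> binexp S p g = binexp S p g'.
Proof. by move=> h; apply: eq_bigr => N _; rewrite h // -ltnS. Qed.

Lemma binexp_widen S S' p g : (S <= S')%N ->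
  binexp S p g =
  \sum_(N < S'.+1) 'C(S, N)%:R * p ^+ N * (1 - p) ^+ (S - N) * g N.
Proof.
move=> le; rewrite /binexp.
rewrite (big_ord_widen S'.+1 (fun N =>
  'C(S, N)%:R * p ^+ N * (1 - p) ^+ (S - N) * g N)) // big_mkcond /=.
apply: eq_bigr => N _; case: ltnP => // lt; by rewrite bin_small // !mul0r.
Qed.

(** With [x = q^J] and [y = q^I], each of the [S] vertices is linked to J only, to I only, or to
    neither, with weights (1 - x) y, x (1 - y), x y; the factors [y ^+ N] and [x ^+ M] exclude being
    linked to both. The two sides sum the same multinomial weights in the two orders. *)
Lemma binexp_swap S x y (h : nat -> nat -> R) :
  binexp S (1 - x) (fun N => y ^+ N * binexp (S - N) (1 - y) (h N)) =
  binexp S (1 - y) (fun M => x ^+ M * binexp (S - M) (1 - x) (h ^~ M)).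
Proof.
have H x' y' (h' : nat -> nat -> R) :
    binexp S (1 - x') (fun N => y' ^+ N * binexp (S - N) (1 - y') (h' N)) =
    \sum_(N < S.+1) \sum_(M < S.+1) 'C(S, N)%:R * (1 - x') ^+ N *
      (1 - (1 - x')) ^+ (S - N) * (y' ^+ N * ('C(S - N, M)%:R * (1 - y') ^+ M *
      (1 - (1 - y')) ^+ (S - N - M) * h' N M)).
  apply: eq_bigr => N _.
  by rewrite (binexp_widen _ _ (leq_subr _ _)) !mulr_sumr.
rewrite !H exchange_big /=; apply: eq_bigr => M _; apply: eq_bigr => N _.
have NS : (N <= S)%N by rewrite -ltnS.
have MS : (M <= S)%N by rewrite -ltnS.
have [lt|le] := ltnP S (N + M).
  have -> : 'C(S - N, M) = 0%N by apply: bin_small; lia.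
  have -> : 'C(S - M, N) = 0%N by apply: bin_small; lia.
  by rewrite !(mul0r, mulr0).
have -> : (1 - (1 - x)) = x by ring.
have -> : (1 - (1 - y)) = y by ring.
have -> : (S - N = M + (S - N - M))%N by lia.
have -> : (S - M = N + (S - N - M))%N by lia.
rewrite !addKn !exprD.
have e : ('C(S, N) * 'C(M + (S - N - M), M) = 'C(S, M) * 'C(N + (S - N - M), N))%N.
  apply/eqP; rewrite -(eqn_pmul2r (m := N`! * M`! * (S - N - M)`!)) ?muln_gt0 ?fact_gt0 //.
  apply/eqP; set K := (S - N - M)%N.
  have h1 := @bin_fact (M + K) M (leq_addr _ _); have h2 := @bin_fact (N + K) N (leq_addr _ _).
  have h3 := bin_fact NS; have h4 := bin_fact MS; rewrite addKn in h1; rewrite addKn in h2.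
  have e1 : (S - N = M + K)%N by lia.
  have e2 : (S - M = N + K)%N by lia.
  rewrite e1 -h1 in h3; rewrite e2 -h2 in h4.
  by transitivity (S`!); [rewrite -h3; ring | rewrite -h4; ring].
have /(congr1 (fun k => k%:R : R)) := e; rewrite !natrM => eR.
transitivity ('C(S, N)%:R * 'C(M + (S - N - M), M)%:R *
  ((1 - x) ^+ N * (1 - y) ^+ M * x ^+ M * y ^+ N * x ^+ (S - N - M) * y ^+ (S - N - M) * h N M)).
  by ring.
by rewrite eR; ring.
Qed.

(** Counting the spared vertices amounts to marking one of them: it is spared with probability
    [1 - p], and the others form a binomial sample of size [S.-1]. *)
Lemma binexp_down S p g :
  binexp S p (fun N => (S - N)%:R * g N) = S%:R * (1 - p) * binexp S.-1 p g.
Proof.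
case: S => [|S]; first by rewrite binexp0 !mul0r.
rewrite /binexp big_ord_recr /= subnn mul0r mulr0 addr0 mulr_sumr.
apply: eq_bigr => N _.
have /(congr1 (fun k => k%:R : R)) := mul_bin_down S.+1 N; rewrite !natrM /= => e.
have NS : (N <= S)%N by rewrite -ltnS.
transitivity ((S.+1 - N)%:R * 'C(S.+1, N)%:R * (p ^+ N * (1 - p) ^+ (S.+1 - N) * g N)).
  by ring.
by rewrite -e subSn // exprS; ring.
Qed.

(* The probability that a set of [I] vertices is not linked to a set of [J]
   vertices by a path of length at most [b + 1] through [S] further vertices. *)
Fixpoint nolink q b S J I : R :=
  q ^+ (I * J)%N *
  (if b is b'.+1 then binexp S (1 - q ^+ J) (fun N => nolink q b' (S - N)%N N I)
   else 1).

(** The factors [q ^+ (I * J)] accumulated along the recursion amount to [q ^+ I] for each vertex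
    ever reached: no vertex of the ball of radius b may have an edge to the I-set. *)
Lemma nolink_rf q b a S J I :
  iter b (rf_step q) (fun a _ J => (q ^+ I) ^+ a * (q ^+ I) ^+ J) a S J =
  (q ^+ I) ^+ a * nolink q b S J I.
Proof.
elim: b a S J => [|b IH] a S J /=; first by rewrite mulr1 (exprM q I J).
rewrite /rf_step (exprM q I J) -/(rf_step q).
under eq_fun do rewrite IH.
rewrite /binexp !mulr_sumr; apply: eq_bigr => N _; rewrite exprD; ring.
Qed.

(** Two levels are unfolded at a time: one step from J, the symmetry at [b.+1], one step from I.
    [binexp_swap] then exchanges the two steps, and the symmetry at [b] closes the argument. Hence
    the strong induction with base cases 0 and 1; the latter is a binomial generating function
    symmetric in [q ^+ J] and [q ^+ I]. *)
Lemma nolink_sym q b S J I : nolink q b S J I = nolink q b S I J.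
Proof.
have [k] := ubnP b; elim: k b S J I => // k IH [|[|b]] S J I bk /=.
- by rewrite mulnC.
- rewrite mulnC; congr (_ * _).
  have H (K L : nat) : binexp S (1 - q ^+ K) (fun N => q ^+ (L * N) * 1) =
      (q ^+ K + (1 - q ^+ K) * q ^+ L) ^+ S.
    under eq_fun do rewrite mulr1 exprM.
    by rewrite binexp_pow; congr (_ ^+ _); ring.
  by rewrite !H; congr (_ ^+ _); ring.
- rewrite mulnC; congr (_ * _).
  have H (K L : nat) : binexp S (1 - q ^+ K) (fun N => nolink q b.+1 (S - N)%N N L) =
      binexp S (1 - q ^+ K) (fun N => (q ^+ L) ^+ N *
        binexp (S - N) (1 - q ^+ L) (fun M => nolink q b (S - N - M)%N M N)).
    apply: eq_binexp => N _; rewrite IH //=.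
    by rewrite mulnC exprM.
  have := H J I; rewrite /= => ->; have := H I J; rewrite /= => ->.
  rewrite binexp_swap; apply: eq_binexp => N _; congr (_ * _).
  apply: eq_binexp => M _; rewrite IH; last by lia.
  by congr (nolink _ _ _ _ _); lia.
Qed.

(** By [binexp_down] one vertex is marked among the [S]; it plays the role of the second endpoint,
    and the other [S.-1] serve as intermediate vertices. *)
Lemma rf_unreached q b a S J :
  iter b.+1 (rf_step q) (fun _ S _ => S%:R) a S J =
  S%:R * nolink q b S.-1 J 1%N.
Proof.
elim: b a S J => [|b IH] a S J.
  rewrite /= /rf_step mul1n mulr1.
  have := binexp_down S (1 - q ^+ J) (fun=> 1).
  under eq_fun do rewrite mulr1.
  move=> ->; rewrite (_ : binexp _ _ (fun=> 1) = 1); first by ring.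
  have := binexp_pow S.-1 (1 - q ^+ J) 1; under eq_fun do rewrite expr1n.
  by move=> ->; rewrite mulr1 subrK expr1n.
rewrite iterS {1}/rf_step; under eq_fun do rewrite IH.
rewrite (binexp_down S (1 - q ^+ J) (fun N => nolink q b (S - N).-1%N N 1%N)) /=.
rewrite mul1n opprB addrCA subrr addr0 -!mulrA; congr (_ * (_ * _)).
by apply: eq_binexp => N _; congr nolink; lia.
Qed.

End Duality.

(** * Moments of the chain, dominated by those of the Poisson branching process *)

Section ChainEstimates.
Variables (R : realType) (m : R) (n : nat).
Hypotheses (m1 : 1 < m) (mn : m <= n%:R).
Let p := m / n%:R.
Let q := 1 - p.
Let kap := m / (m - 1).
Implicit Types (t r : R).

Let n0 : (0 : R) < n%:R.
Proof. by apply: lt_le_trans mn; apply: lt_trans m1. Qed.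

Let p01 : 0 <= p <= 1.
Proof.
have m0 : 0 <= m by rewrite (le_trans _ (ltW m1)).
by rewrite /p divr_ge0 ?(ltW n0) //= ler_pdivrMr // mul1r.
Qed.

Let q01 : 0 <= q <= 1.
Proof. by rewrite /q; case/andP: p01 => a b; lra. Qed.

Let pn : n%:R * p = m.
Proof. by rewrite /p mulrCA divff ?mulr1 // gt_eqF. Qed.

Let kapE : kap * m = kap + m.
Proof. by rewrite /kap; field; rewrite subr_eq0 gt_eqF. Qed.

Let kap1 : 1 <= kap.
Proof. by rewrite /kap ler_pdivlMr ?subr_gt0 // mul1r gerBl. Qed.

Let m0 : 0 <= m. Proof. by rewrite (le_trans _ (ltW m1)). Qed.

Lemma infection01 J : 0 <= 1 - q ^+ J <= 1.
Proof.
by case/andP: q01 => a b; rewrite subr_ge0 exprn_ile1 // lerBlDr lerDl exprn_ge0.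
Qed.

Lemma infection_le J : 1 - q ^+ J <= J%:R * p.
Proof. by have := pow_onem_ge J p01; rewrite -/q; lra. Qed.

Lemma infection_ge J : J%:R * p - (J%:R * p) ^+ 2 <= 1 - q ^+ J.
Proof. by have := pow_onem_le J p01; rewrite -/q; lra. Qed.

Lemma infected_le S J : (S <= n)%N -> S%:R * (1 - q ^+ J) <= m * J%:R.
Proof.
move=> Sn; have /andP[a b] := infection01 J.
apply: (@le_trans _ _ (n%:R * (J%:R * p))).
  by rewrite ler_pM // ?ler_nat // infection_le.
by rewrite mulrCA pn mulrC.
Qed.

Lemma binexp_quad_le S J (c0 c1 c2 : R) : (S <= n)%N -> 0 <= c1 -> 0 <= c2 ->
  binexp S (1 - q ^+ J) (fun N => c0 + c1 * N%:R + c2 * N%:R ^+ 2) <=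
  c0 + c1 * (m * J%:R) + c2 * (m ^+ 2 * J%:R ^+ 2 + m * J%:R).
Proof.
move=> Sn c10 c20; rewrite binexp_quad; have h := infected_le J Sn.
have /andP[a b] := infection01 J.
have h0 : 0 <= S%:R * (1 - q ^+ J) by rewrite mulr_ge0.
rewrite lerD // ?lerD2l; first by rewrite ler_wpM2l.
rewrite ler_wpM2l // lerD //.
  by rewrite -exprMn lerXn2r // nnegrE // mulr_ge0.
by apply: le_trans h; rewrite ler_piMr // lerBlDr lerDl.
Qed.

Section Moments.
Variable S0 : nat.
Hypothesis S0n : (S0 <= n)%N.
Local Notation E k g := (iter k (rf_step q) g 0%N S0 1%N).

(** Conditioning on the state before the last step, so that a one-step bound valid in every state
    gives a recursion in [k]. *)
Lemma E_drift k (g h : nat -> nat -> nat -> R) :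
  (forall a S J, (S <= n)%N -> rf_step q g a S J <= h a S J) ->
  E k.+1 g <= E k h.
Proof.
move=> gh; rewrite iterSr; apply: ler_rf => // a S J SS0 _.
by apply: gh; exact: leq_trans SS0 S0n.
Qed.

Lemma binexp_lin_le S J (c0 c1 : R) : (S <= n)%N -> 0 <= c1 ->
  binexp S (1 - q ^+ J) (fun N => c0 + c1 * N%:R) <= c0 + c1 * (m * J%:R).
Proof.
move=> Sn c10; have := binexp_quad_le J c0 Sn c10 (lexx 0).
rewrite mul0r addr0; congr (_ <= _); congr binexp.
by apply/funext => N; rewrite mul0r addr0.
Qed.

Lemma E_J k : E k (fun _ _ J => J%:R) <= m ^+ k.
Proof.
elim: k => [|k IH] //; rewrite exprS.
apply: le_trans (ler_wpM2l m0 IH); rewrite -(rfZ q01).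
apply: E_drift => a S J Sn; rewrite /rf_step.
have := binexp_lin_le J 0 Sn ler01; rewrite mul1r add0r; congr (_ <= _).
by congr binexp; apply/funext => N; rewrite mul1r add0r.
Qed.

(** The bound is the exact second moment of the Poisson branching process, as that of [E_y] is its
    exact mean total progeny. Keeping the subtracted terms makes both inductions close with
    equality. *)
Lemma E_JJ k :
  E k (fun _ _ J => J%:R ^+ 2) <= kap * (m ^+ k) ^+ 2 - (kap - 1) * m ^+ k.
Proof.
elim: k => [|k IH]; first by rewrite /= !expr0 expr1n; lra.
have h : E k.+1 (fun _ _ J => J%:R ^+ 2) <=
    E k (fun a S J => m ^+ 2 * J%:R ^+ 2 + m * J%:R).
  apply: E_drift => a S J Sn; rewrite /rf_step.
  have := binexp_quad_le J 0 Sn (lexx 0) ler01; rewrite mul1r mul0r !add0r.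
  congr (_ <= _); congr binexp.
  by apply/funext => N; rewrite mul1r mul0r !add0r.
apply: le_trans h _; rewrite (rfD q01) !(rfZ q01) [m ^+ k.+1]exprS.
have := ler_wpM2l (sqr_ge0 m) IH; have := ler_wpM2l m0 (E_J k).
set M := m ^+ k; set X := E k _; set Y := E k _ => h1 h2.
apply: (le_trans (lerD h2 h1)); rewrite le_eqVlt; apply/orP; left; apply/eqP.
have e := kapE.
transitivity (kap * (m * M) ^+ 2 - m * M * (kap * m - m - 1)); first by ring.
by rewrite e; ring.
Qed.

Lemma E_y k :
  E k (fun a _ J => (a + J)%N%:R) <= kap * m ^+ k - (kap - 1).
Proof.
elim: k => [|k IH]; first by rewrite /= !expr0; lra.
have h : E k.+1 (fun a _ J => (a + J)%N%:R) <=
    E k (fun a S J => (a + J)%N%:R + m * J%:R).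
  apply: E_drift => a S J Sn; rewrite /rf_step.
  have := binexp_lin_le J (a + J)%N%:R Sn ler01; rewrite mul1r.
  congr (_ <= _); congr binexp.
  by apply/funext => N; rewrite mul1r [in RHS]natrD.
apply: le_trans h _; rewrite (rfD q01) !(rfZ q01) [m ^+ k.+1]exprS.
have := ler_wpM2l m0 (E_J k); move: IH.
set M := m ^+ k; set X := E k _; set Y := E k _ => h1 h2.
apply: (le_trans (lerD h1 h2)); rewrite le_eqVlt; apply/orP; left; apply/eqP.
by rewrite (mulrA kap) kapE; ring.
Qed.

Lemma E_Jy k :
  E k (fun a _ J => J%:R * (a + J)%N%:R) <= kap ^+ 2 * (m ^+ k) ^+ 2.
Proof.
elim: k => [|k IH].
  by rewrite /= !expr0 expr1n mulr1 mul1r exprn_ege1.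
have h : E k.+1 (fun a _ J => J%:R * (a + J)%N%:R) <=
    E k (fun a S J => m * (J%:R * (a + J)%N%:R) + (m ^+ 2 * J%:R ^+ 2 + m * J%:R)).
  apply: E_drift => a S J Sn; rewrite /rf_step.
  have := binexp_quad_le J 0 Sn (ler0n R (a + J)%N) ler01.
  rewrite mul1r add0r mulrA (mulrC _ m) -mulrA (mulrC (a + J)%N%:R).
  congr (_ <= _); congr binexp.
  by apply/funext => N; rewrite mul1r (natrD _ (a + J)%N); ring.
apply: le_trans h _; rewrite !(rfD q01) !(rfZ q01) [m ^+ k.+1]exprS.
have := ler_wpM2l (sqr_ge0 m) (E_JJ k).
have := ler_wpM2l m0 (E_J k); have := ler_wpM2l m0 IH.
have M0 : 0 <= m ^+ k by rewrite exprn_ge0.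
move: M0; set M := m ^+ k; set X := E k _; set Y := E k _; set Z := E k _ => M0 h1 h2 h3.
apply: (le_trans (lerD h1 (lerD h3 h2))); have e := kapE.
rewrite -subr_ge0.
have -> : kap ^+ 2 * (m * M) ^+ 2 = kap * (kap * m) * m * M ^+ 2 by ring.
rewrite e; have := kap1 => k1.
rewrite (_ : _ - _ = m * M * (kap * m - m - 1)); last by ring.
by rewrite e !mulr_ge0 //; lra.
Qed.

Lemma E_yy k :
  E k (fun a _ J => (a + J)%N%:R ^+ 2) <= 3 * kap ^+ 3 * (m ^+ k) ^+ 2.
Proof.
have k1 := kap1; have e := kapE; have := m1 => lt1m.
elim: k => [|k IH].
  by rewrite /= !expr0 expr1n; have := @exprn_ege1 _ 3 _ k1; lra.
have h : E k.+1 (fun a _ J => (a + J)%N%:R ^+ 2) <=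
    E k (fun a S J => (a + J)%N%:R ^+ 2 + 2 * m * (J%:R * (a + J)%N%:R)
       + (m ^+ 2 * J%:R ^+ 2 + m * J%:R)).
  apply: E_drift => a S J Sn; rewrite /rf_step.
  have c0 : (0 : R) <= 2 * (a + J)%N%:R by rewrite mulr_ge0.
  have := binexp_quad_le J ((a + J)%N%:R ^+ 2) Sn c0 ler01.
  rewrite mul1r (_ : 2 * _ * (m * _) = 2 * m * (J%:R * (a + J)%N%:R)); last by ring.
  congr (_ <= _); congr binexp.
  by apply/funext => N; rewrite mul1r (natrD _ (a + J)%N); ring.
apply: le_trans h _; rewrite !(rfD q01) !(rfZ q01) [m ^+ k.+1]exprS.
have := ler_wpM2l (sqr_ge0 m) (E_JJ k).
have m20 : 0 <= 2 * m by rewrite mulr_ge0.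
have := ler_wpM2l m0 (E_J k); have := ler_wpM2l m20 (E_Jy k).
have M0 : 0 <= m ^+ k by rewrite exprn_ge0.
move: M0 IH; set M := m ^+ k; set X := E k _; set Y := E k _; set Z := E k _;
  set U := E k _ => M0 h0 h1 h2 h3.
apply: (le_trans (lerD (lerD h0 h1) (lerD h3 h2))).
rewrite -subr_ge0.
have -> : 3 * kap ^+ 3 * (m * M) ^+ 2 = 3 * kap * (kap * m) ^+ 2 * M ^+ 2 by ring.
rewrite e.
rewrite (_ : _ - _ = m * M * (kap * m - m - 1) +
  M ^+ 2 * kap * (4 * kap * m + 2 * m ^+ 2)); last by ring.
have k0 : 0 <= kap by lra.
rewrite e addr_ge0 //; first by rewrite !mulr_ge0 //; lra.
by rewrite ?(k0, m0, mulr_ge0, addr_ge0, sqr_ge0).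
Qed.

End Moments.
End ChainEstimates.

(** * Comparison with the branching process *)

Section OffspringPgf.
Variables (R : realType) (m : R).
Hypothesis m1 : 1 < m.
Let kap := m / (m - 1).
Implicit Types (t r s x : R).

Let m0 : 0 < m. Proof. exact: lt_trans m1. Qed.

Let kapE : kap * m = kap + m.
Proof. by rewrite /kap; field; rewrite subr_eq0 gt_eqF. Qed.

Let kap1 : 1 <= kap.
Proof. by rewrite /kap ler_pdivlMr ?subr_gt0 // mul1r gerBl. Qed.

Definition poisson_pgf s : R := expR (- (m * (1 - s))).

Lemma poisson_pgf_lip s x : s <= 1 -> x <= 1 ->
  `|poisson_pgf s - poisson_pgf x| <= m * `|s - x|.
Proof.
move=> s1 x1; apply: le_trans (expR_lip _ _) _.
- by rewrite oppr_le0 mulr_ge0 ?(ltW m0) // subr_ge0.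
- by rewrite oppr_le0 mulr_ge0 ?(ltW m0) // subr_ge0.
rewrite (_ : _ - _ = m * (s - x)); last by ring.
by rewrite normrM gtr0_norm.
Qed.

Lemma poisson_pgf01 s : s <= 1 -> 0 < poisson_pgf s <= 1.
Proof.
by move=> s1; rewrite expR_gt0 expR_le1 oppr_le0 mulr_ge0 ?(ltW m0) // subr_ge0.
Qed.

(* With generation sizes [Z_i]: the expectation of
   [r ^ (Z_0 + ... + Z_(b-1)) * t ^ Z_b]. *)
Definition progeny_pgf r t b : R := iter b (fun s => r * poisson_pgf s) t.

Lemma progeny_pgf01 r t b : 0 <= r <= 1 -> 0 <= t <= 1 ->
  0 <= progeny_pgf r t b <= 1.
Proof.
move=> /andP[r0 r1] t01; elim: b => //= b /andP[_ IH].
have /andP[a0 a1] := poisson_pgf01 IH.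
by rewrite mulr_ge0 ?(ltW a0) //= mulr_ile1 // ltW.
Qed.

(** Union bound: as [t <= r], each individual costs at most [1 - t], and the last factor is the mean
    total progeny up to generation b. *)
Lemma progeny_pgf_ge r t b : 0 <= t <= r -> r <= 1 ->
  1 - progeny_pgf r t b <= (1 - t) * (kap * m ^+ b - (kap - 1)).
Proof.
move=> /andP[t0 tr] r1; elim: b => [|b IH].
  by rewrite expr0 (_ : kap * 1 - (kap - 1) = 1) ?mulr1 //; ring.
have /andP[s0 s1] : 0 <= progeny_pgf r t b <= 1.
  by apply: progeny_pgf01; rewrite ?t0 ?r1 ?(le_trans t0) ?(le_trans tr).
rewrite /= -/(progeny_pgf r t b); move: IH s0 s1.
set s := progeny_pgf r t b => IH s0 s1.
have h : 1 - r * poisson_pgf s <= 1 - t + m * (1 - s).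
  have := expRN_ge (m * (1 - s)); have /andP[a0 a1] := poisson_pgf01 s1.
  rewrite -/(poisson_pgf s) => h; have r0 : 0 <= r by exact: le_trans tr.
  have : 0 <= m * (1 - s) by rewrite mulr_ge0 ?(ltW m0) // subr_ge0.
  move: (ler_wpM2l r0 h); set y := m * _ => h1 y0.
  have : r * y <= y by rewrite ler_piMl.
  lra.
apply: le_trans h _; rewrite exprS.
have := ler_wpM2l (ltW m0) IH; set M := m ^+ b => h.
apply: le_trans (lerD (lexx _) h) _; rewrite le_eqVlt; apply/orP; left.
apply/eqP.
transitivity ((1 - t) * (kap * m * M - (kap * m - m - 1))); first by ring.
by rewrite [kap * (m * M)]mulrA kapE; ring.
Qed.

Lemma progeny_pgf_ge' r t b : 0 <= t <= r -> r <= 1 ->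
  1 - progeny_pgf r t b <= (1 - t) * (kap * m ^+ b).
Proof.
move=> tr r1; apply: le_trans (progeny_pgf_ge _ tr r1) _; apply: ler_wpM2l.
  by case/andP: tr => t0 tr; rewrite subr_ge0 (le_trans tr).
by rewrite gerBl subr_ge0.
Qed.

Section Approximation.
Variables (n : nat).
Hypothesis mn : m <= n%:R.
Let q := 1 - m / n%:R.

Let n0 : (0 : R) < n%:R.
Proof. by apply: lt_le_trans mn. Qed.

Let q01 : 0 <= q <= 1.
Proof.
have : m / n%:R <= 1 by rewrite ler_pdivrMr // mul1r.
have : 0 < m / n%:R by rewrite divr_gt0.
rewrite /q; lra.
Qed.

(** Two comparisons: each factor [1 - P x] with its exponential, then the mean [S P] with [m J],
    where the loss comes from depletion ([n - S]) and from vertices linked several times ([J^2]).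
    Both differences retain the small factor [1 - s]. *)
Lemma infected_pgf S J s : (S <= n)%N -> 0 <= s <= 1 ->
  `|binexp S (1 - q ^+ J) (fun N => s ^+ N) - poisson_pgf s ^+ J|
    <= (1 - s) / n%:R * (m * J%:R * (n%:R - S%:R) + 2 * (m * J%:R) ^+ 2).
Proof.
move=> Sn /andP[s0 s1]; rewrite binexp_pow.
set x := 1 - s; set P := 1 - q ^+ J.
have x0 : 0 <= x by rewrite /x subr_ge0.
have x1 : x <= 1 by rewrite /x gerBl.
have /andP[P0 P1] : 0 <= P <= 1 := infection01 m1 mn J.
have Ple : P <= J%:R * (m / n%:R) := infection_le m1 mn J.
have Pge : J%:R * (m / n%:R) - (J%:R * (m / n%:R)) ^+ 2 <= P := infection_ge m1 mn J.
have SP : S%:R * P <= m * J%:R := infected_le m1 mn J Sn.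
have Px0 : 0 <= P * x by rewrite mulr_ge0.
have Px1 : P * x <= 1 by rewrite mulr_ile1.
have SR : (S%:R : R) <= n%:R by rewrite ler_nat.
have np : n%:R * (m / n%:R) = m by rewrite mulrCA divff ?mulr1 // gt_eqF.
have -> : 1 - P + P * s = 1 - P * x by rewrite /x; ring.
rewrite (le_trans (ler_distD (expR (- (P * x)) ^+ S) _ _)) //.
have d1 : `|(1 - P * x) ^+ S - expR (- (P * x)) ^+ S| <= x / n%:R * (m * J%:R) ^+ 2.
  apply: le_trans (pow_lip _ _ _) _.
  - by rewrite subr_ge0 Px1 gerBl.
  - by rewrite expR_ge0 expR_le1 oppr_le0.
  rewrite distrC ger0_norm ?subr_ge0 ?expRN_ge //.
  apply: (@le_trans _ _ (S%:R * (P * x) ^+ 2)).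
    by rewrite ler_wpM2l //; have := expRN_le Px0; lra.
  apply: (@le_trans _ _ (S%:R * P * (J%:R * (m / n%:R)) * x)).
    rewrite (_ : _ * _ = S%:R * P * (P * x) * x); last by ring.
    rewrite ler_wpM2r // ler_wpM2l ?mulr_ge0 //.
    by rewrite (le_trans _ Ple) // ler_piMr.
  rewrite (_ : x / _ * _ = m * J%:R * (J%:R * (m / n%:R)) * x); last by ring.
  by rewrite ler_wpM2r // ler_wpM2r // mulr_ge0 // divr_ge0 ?(ltW m0).
have d2 : `|expR (- (P * x)) ^+ S - poisson_pgf s ^+ J| <=
    x / n%:R * (m * J%:R * (n%:R - S%:R) + (m * J%:R) ^+ 2).
  rewrite -!expRM_natl /poisson_pgf -/x.
  apply: le_trans (expR_lip _ _) _.
  - by rewrite mulrN oppr_le0 mulr_ge0.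
  - by rewrite mulrN oppr_le0 mulr_ge0 // mulr_ge0 ?(ltW m0).
  rewrite (_ : _ - _ = (m * J%:R - S%:R * P) * x); last by ring.
  rewrite ger0_norm; last by rewrite mulr_ge0 // subr_ge0.
  rewrite mulrAC -[leRHS]mulrA [leRHS]mulrC ler_wpM2r //.
  have SPge : S%:R * (J%:R * (m / n%:R)) - S%:R * (J%:R * (m / n%:R)) ^+ 2 <= S%:R * P.
    by rewrite -mulrBr ler_wpM2l.
  have : S%:R * (J%:R * (m / n%:R)) ^+ 2 <= n%:R * (J%:R * (m / n%:R)) ^+ 2.
    by rewrite ler_wpM2r // sqr_ge0.
  rewrite (_ : n%:R * (J%:R * (m / n%:R)) ^+ 2 =
     (m * J%:R) ^+ 2 / n%:R * (n%:R * n%:R^-1)); last by ring.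
  rewrite divff ?gt_eqF // mulr1 mulrDl => h.
  rewrite (_ : _ * _ / n%:R = m * J%:R * (n%:R * n%:R^-1) - S%:R * (J%:R * (m / n%:R))); last by ring.
  rewrite divff ?gt_eqF // mulr1; lra.
by apply: le_trans (lerD d1 d2) _; rewrite le_eqVlt; apply/orP; left; apply/eqP; ring.
Qed.

End Approximation.
End OffspringPgf.

(** * Error recursion for the generating functions of the chain *)

Section PgfApproximation.
Variables (R : realType) (m : R) (n : nat).
Hypotheses (m1 : 1 < m) (mn : m <= n%:R).
Let kap := m / (m - 1).
Let q := 1 - m / n%:R.
Implicit Types (t r s x : R).

Let m0 : 0 < m. Proof. exact: lt_trans m1. Qed.

Let n0 : (0 : R) < n%:R. Proof. by apply: lt_le_trans mn. Qed.

Let kapE : kap * m = kap + m.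
Proof. by rewrite /kap; field; rewrite subr_eq0 gt_eqF. Qed.

Let kap1 : 1 <= kap.
Proof. by rewrite /kap ler_pdivlMr ?subr_gt0 // mul1r gerBl. Qed.

Let q01 : 0 <= q <= 1.
Proof.
have : m / n%:R <= 1 by rewrite ler_pdivrMr // mul1r.
have : 0 < m / n%:R by rewrite divr_gt0.
rewrite /q; lra.
Qed.

(* The coefficients of [J^2], [J] and [J (n - S)] solve the linear recursions
   produced by one step of the chain. *)
Let c1 b : R := kap ^+ 3 * (m ^+ b) ^+ 2 - (kap ^+ 2 * b%:R + kap ^+ 3) * m ^+ b.
Let c2 b : R := kap ^+ 3 * m ^+ b * (m ^+ b - 1) * (kap - 1).
Let c3 b : R := kap * b%:R * m ^+ b.

Let c1S b : c1 b.+1 = m ^+ 2 * (c1 b + c3 b + kap * m ^+ b).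
Proof.
rewrite /c1 /c3 [m ^+ b.+1]exprS -natr1; set M := m ^+ b; set B := b%:R.
apply/eqP; rewrite -subr_eq0.
rewrite (_ : _ - _ = m * M * (kap * B + kap ^+ 2 + kap) * (kap * m - (kap + m))).
  by rewrite kapE subrr mulr0.
by ring.
Qed.

Let c3S b : c3 b.+1 = m * (c3 b + kap * m ^+ b).
Proof. by rewrite /c3 exprS -natr1; ring. Qed.

Let c3_ge0 b : 0 <= c3 b.
Proof.
have k0 : 0 <= kap by apply: le_trans kap1.
have M0 : 0 <= m ^+ b by rewrite exprn_ge0 // ltW.
by rewrite /c3 ?(k0, M0, mulr_ge0).
Qed.

Let c1_ge0 b : 0 <= c1 b.
Proof.
have k0 : 0 <= kap by apply: le_trans kap1.
elim: b => [|b IH]; first by rewrite /c1 expr0; lra.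
have M0 : 0 <= m ^+ b by rewrite exprn_ge0 // ltW.
by rewrite c1S mulr_ge0 ?sqr_ge0 // addr_ge0 ?(mulr_ge0 k0) // addr_ge0 // c3_ge0.
Qed.

Let c13_le b : c1 b + c3 b <= kap ^+ 3 * (m ^+ b) ^+ 2.
Proof.
rewrite /c1 /c3; set M := m ^+ b; set B := (b%:R : R).
have M0 : 0 <= M by rewrite exprn_ge0 // ltW.
have B0 : 0 <= B by [].
have k0 : 0 <= kap by apply: le_trans kap1.
have k1 : 0 <= kap - 1 by rewrite subr_ge0.
have h1 : 0 <= kap * (kap - 1) * B * M by rewrite ?(k0, k1, B0, M0, mulr_ge0).
have h2 : 0 <= kap ^+ 3 * M by rewrite mulr_ge0 // exprn_ge0.
rewrite -subr_ge0 (_ : _ - _ = kap * (kap - 1) * B * M + kap ^+ 3 * M); last by ring.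
exact: addr_ge0.
Qed.

Let c2S b : m * (c1 b + c2 b + c3 b) <= c2 b.+1.
Proof.
have h : m * (c1 b + c3 b) <= m * (kap ^+ 3 * (m ^+ b) ^+ 2).
  by apply: ler_wpM2l; [exact: ltW|exact: c13_le].
rewrite (_ : c1 b + c2 b + c3 b = c1 b + c3 b + c2 b); last by ring.
rewrite mulrDr; apply: le_trans (lerD h (lexx _)) _.
rewrite /c2 [m ^+ b.+1]exprS; set M := m ^+ b.
rewrite le_eqVlt; apply/orP; left; apply/eqP.
transitivity (kap ^+ 3 * (m * M) * (M + (M - 1) * (kap - 1))); first by ring.
(* The inserted factor equals 1 by [kapE]. *)
transitivity (kap ^+ 3 * (m * M) * (M * (kap * m - m - kap + 1) + (M - 1) * (kap - 1))).
  by rewrite kapE; ring.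
by ring.
Qed.

Let c2_ge0 b : 0 <= c2 b.
Proof.
have k0 : 0 <= kap by apply: le_trans kap1.
have k1 : 0 <= kap - 1 by rewrite subr_ge0.
have M0 : 0 <= m ^+ b by rewrite exprn_ge0 // ltW.
have M1 : 0 <= m ^+ b - 1 by rewrite subr_ge0 exprn_ege1 // ltW.
have K0 := exprn_ge0 3 k0.
by rewrite /c2 ?(K0, k1, M0, M1, mulr_ge0).
Qed.

(** The bound is a quadratic form in the state: the first step averages the inductive error ([d1])
    and adds its own error at argument [G] ([d2]), whose defect [1 - G] is at most
    [(1 - t) kap m^b]. *)
Let rf_progeny_pgf_aux r t b a S J : 0 <= t <= r -> r <= 1 -> (S <= n)%N ->
  `|iter b (rf_step q) (fun a _ J => r ^+ a * t ^+ J) a S J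
     - r ^+ a * progeny_pgf m r t b ^+ J| <=
  2 * (1 - t) / n%:R *
  (c1 b * J%:R ^+ 2 + c2 b * J%:R + c3 b * (J%:R * (n%:R - S%:R))).
Proof.
move=> tr r1; have /andP[t0 tr'] := tr; have r0 := le_trans t0 tr'.
have w0 : 0 <= 2 * (1 - t) / n%:R.
  by rewrite divr_ge0 ?(ltW n0) // mulr_ge0 // subr_ge0 (le_trans tr').
elim: b a S J => [|b IH] a S J Sn.
  rewrite /= subrr normr0 mulr_ge0 //.
  have nS : 0 <= (n%:R - S%:R : R) by rewrite subr_ge0 ler_nat.
  apply: addr_ge0; first apply: addr_ge0; apply: mulr_ge0; rewrite ?sqr_ge0 //.
  exact: mulr_ge0.
rewrite iterS; set g := iter b _ _; set G := progeny_pgf m r t b.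
have G01 : 0 <= G <= 1.
  by apply: progeny_pgf01; rewrite ?r0 ?t0 ?(le_trans tr').
pose M := m ^+ b.
have d1 : `|rf_step q g a S J - rf_step q (fun a _ J => r ^+ a * G ^+ J) a S J| <=
   2 * (1 - t) / n%:R * ((c2 b + c3 b * (n%:R - S%:R)) * (m * J%:R)
     + (c1 b + c3 b) * (m ^+ 2 * J%:R ^+ 2 + m * J%:R)).
  pose e (a' S' J' : nat) := 2 * (1 - t) / n%:R *
    (c1 b * J'%:R ^+ 2 + c2 b * J'%:R + c3 b * (J'%:R * (n%:R - S'%:R))).
  have := @rf_dist R q q01 1 g (fun a _ J => r ^+ a * G ^+ J) e a S J.
  move/(_ (fun a' S' J' S'S _ => IH a' S' J' (leq_trans S'S Sn))) => h.
  apply: le_trans h _; rewrite /e (rfZ q01); apply: ler_wpM2l => //=; rewrite /rf_step.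
  have nS : 0 <= (n%:R - S%:R : R) by rewrite subr_ge0 ler_nat.
  have k1 : 0 <= c2 b + c3 b * (n%:R - S%:R).
    by apply: addr_ge0 => //; exact: mulr_ge0.
  have k2 : 0 <= c1 b + c3 b by apply: addr_ge0.
  have := binexp_quad_le m1 mn J 0 Sn k1 k2; rewrite !add0r; congr (_ <= _).
  (* Since n - (S - N) = (n - S) + N, the depletion term also feeds the coefficient of [N^2]. *)
  by apply: eq_binexp => N NS; rewrite natrB //; ring.
have d2 : `|rf_step q (fun a _ J => r ^+ a * G ^+ J) a S J -
    r ^+ a * progeny_pgf m r t b.+1 ^+ J| <=
    2 * (1 - t) / n%:R * (kap * M * (m * J%:R * (n%:R - S%:R) + (m * J%:R) ^+ 2)).
  rewrite /rf_step /= -/(progeny_pgf m r t b) -/G.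
  rewrite [binexp _ _ _](_ : _ = r ^+ (a + J) * binexp S (1 - q ^+ J) (fun N => G ^+ N)); last first.
    by rewrite /binexp mulr_sumr; apply: eq_bigr => N _; ring.
  rewrite exprMn mulrA -exprD -mulrBr normrM.
  apply: (@le_trans _ _ ((1 - G) / n%:R *
     (m * J%:R * (n%:R - S%:R) + 2 * (m * J%:R) ^+ 2))).
    apply: le_trans (infected_pgf m1 mn J Sn G01).
    by rewrite ler_piMl // ger0_norm ?exprn_ge0 // exprn_ile1.
  have xG : 1 - G <= (1 - t) * (kap * M) by exact: progeny_pgf_ge'.
  have nS : 0 <= (n%:R - S%:R : R) by rewrite subr_ge0 ler_nat.
  have u0 : 0 <= m * J%:R * (n%:R - S%:R) by rewrite !mulr_ge0 // ltW.
  apply: (@le_trans _ _ ((1 - t) * (kap * M) / n%:R *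
     (2 * (m * J%:R * (n%:R - S%:R) + (m * J%:R) ^+ 2)))).
    apply: ler_pM.
    - by rewrite divr_ge0 ?(ltW n0) // subr_ge0; case/andP: G01.
    - by rewrite addr_ge0 // mulr_ge0 // sqr_ge0.
    - by rewrite ler_wpM2r // invr_ge0 ltW.
    - by lra.
  by rewrite le_eqVlt; apply/orP; left; apply/eqP; ring.
rewrite (le_trans (ler_distD (rf_step q (fun a _ J => r ^+ a * G ^+ J) a S J) _ _)) //.
apply: le_trans (lerD d1 d2) _; rewrite -mulrDr ler_wpM2l //.
have := c2S b; rewrite c1S c3S -/M => h.
have := ler_wpM2r (ler0n R J) h; set K := (J%:R : R); set N := n%:R - _.
lra.
Qed.

Lemma rf_progeny_pgf r t b a S J : 0 <= t <= r -> r <= 1 -> (S <= n)%N ->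
  `|iter b (rf_step q) (fun a _ J => r ^+ a * t ^+ J) a S J
     - r ^+ a * progeny_pgf m r t b ^+ J| <=
  2 * (1 - t) / n%:R *
  (kap ^+ 3 * (m ^+ b) ^+ 2 * J%:R ^+ 2 + kap ^+ 4 * (m ^+ b) ^+ 2 * J%:R
   + kap * b%:R * m ^+ b * (J%:R * (n%:R - S%:R))).
Proof.
move=> tr r1 Sn; apply: le_trans (rf_progeny_pgf_aux _ _ _ tr r1 Sn) _.
have /andP[t0 tr'] := tr.
have k0 : 0 <= kap by apply: le_trans kap1.
have M0 : 0 <= m ^+ b by rewrite exprn_ge0 // ltW.
apply: ler_wpM2l.
  by rewrite divr_ge0 ?(ltW n0) // mulr_ge0 // subr_ge0 (le_trans tr').
rewrite -/(c3 b) lerD2r lerD //.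
  rewrite ler_wpM2r ?sqr_ge0 // (le_trans _ (c13_le b)) // lerDl; exact: c3_ge0.
rewrite ler_wpM2r // /c2; set M := m ^+ b in M0 *.
have K0 := exprn_ge0 3 k0.
have K1 : 0 <= kap - 1 + M by rewrite addr_ge0 // subr_ge0.
have : 0 <= kap ^+ 3 * M * (kap - 1 + M) by rewrite ?(K0, K1, M0, mulr_ge0).
have -> : kap ^+ 3 * M * (M - 1) * (kap - 1) =
  kap ^+ 4 * M ^+ 2 - kap ^+ 3 * M * (kap - 1 + M) by ring.
lra.
Qed.

End PgfApproximation.

Local Open Scope classical_set_scope.
Local Open Scope ring_scope.

(** * The transform [phi], handled only as a limit of iterated generating functions *)

Section LimitTransform.
Variables (R : realType) (m : R).
Hypothesis m1 : 1 < m.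
Let kap := m / (m - 1).
Implicit Types (t r s x c : R).

Let m0 : 0 < m. Proof. exact: lt_trans m1. Qed.

Let kapE : kap * m = kap + m.
Proof. by rewrite /kap; field; rewrite subr_eq0 gt_eqF. Qed.

Let kap1 : 1 <= kap.
Proof. by rewrite /kap ler_pdivlMr ?subr_gt0 // mul1r gerBl. Qed.

Let k0 : 0 <= kap. Proof. by apply: le_trans kap1. Qed.

Lemma gw_pgf01 s b : 0 <= s <= 1 -> 0 <= progeny_pgf m 1 s b <= 1.
Proof. by move=> s01; apply: progeny_pgf01 => //; rewrite ler01 lexx. Qed.

Lemma gw_pgf_lip s x b : 0 <= s <= 1 -> 0 <= x <= 1 ->
  `|progeny_pgf m 1 s b - progeny_pgf m 1 x b| <= m ^+ b * `|s - x|.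
Proof.
move=> s01 x01; elim: b => [|b IH]; first by rewrite expr0 mul1r.
rewrite /= !mul1r -!/(progeny_pgf m 1 _ b).
apply: le_trans (poisson_pgf_lip m1 _ _) _.
- by case/andP: (gw_pgf01 b s01).
- by case/andP: (gw_pgf01 b x01).
by rewrite exprS -mulrA; apply: ler_wpM2l => //; exact: ltW.
Qed.

Lemma gw_pgf1 b : progeny_pgf m 1 1 b = 1.
Proof.
elim: b => //= b IH; rewrite -/(progeny_pgf m 1 1 b) IH.
by rewrite mul1r /poisson_pgf subrr mulr0 oppr0 expR0.
Qed.

Let expRN01 c : 0 <= c -> 0 <= expR (- c) <= 1.
Proof. by move=> c0; rewrite expR_ge0 expR_le1 oppr_le0. Qed.

Lemma gw_pgf_ge c b : 0 <= c ->
  1 - m ^+ b * c <= progeny_pgf m 1 (expR (- c)) b.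
Proof.
move=> c0; have := gw_pgf_lip b (expRN01 c0) (_ : 0 <= 1 <= 1).
rewrite ler01 lexx => /(_ isT); rewrite gw_pgf1 !(distrC _ 1) => h.
have h2 : `|1 - expR (- c)| <= c.
  by rewrite ger0_norm ?subr_ge0 ?expR_le1 ?oppr_le0 //; have := expRN_ge c; lra.
have M0 : 0 <= m ^+ b by rewrite exprn_ge0 // ltW.
have := le_trans h (ler_wpM2l M0 h2); have := ler_norm (1 - progeny_pgf m 1 (expR (- c)) b).
lra.
Qed.

(** With X = m^b c, the identity kap (m X)^2 = m kap X^2 + (m X)^2 says that the inherited quadratic
    error and the new one from the exponential add up to the claimed one, uniformly in b. *)
Lemma gw_pgf_le c b : 0 <= c ->
  progeny_pgf m 1 (expR (- c)) b <= 1 - m ^+ b * c + kap * (m ^+ b * c) ^+ 2.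
Proof.
move=> c0; elim: b => [|b IH].
  rewrite /= expr0 !mul1r; apply: le_trans (expRN_le c0) _.
  by rewrite lerD2l ler_peMl // sqr_ge0.
have := gw_pgf_ge b c0; have /andP[] := gw_pgf01 b (expRN01 c0).
move: IH; rewrite /= mul1r -/(progeny_pgf m 1 _ b) /poisson_pgf.
set y := progeny_pgf _ _ _ _ => IH y0 y1 yge.
have z0 : 0 <= m * (1 - y) by rewrite mulr_ge0 ?(ltW m0) // subr_ge0.
apply: le_trans (expRN_le z0) _; rewrite [m ^+ b.+1]exprS.
set M := m ^+ b in IH yge *.
have MC0 : 0 <= M * c by rewrite mulr_ge0 // exprn_ge0 // ltW.
have h1 : (m * (1 - y)) ^+ 2 <= (m * (M * c)) ^+ 2.
  rewrite lerXn2r ?nnegrE //; first by rewrite mulr_ge0 // ltW.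
  by rewrite ler_wpM2l ?(ltW m0) //; lra.
have h2 : m * (M * c - kap * (M * c) ^+ 2) <= m * (1 - y).
  by rewrite ler_wpM2l ?(ltW m0) //; lra.
rewrite -(mulrA m M); set X := M * c in h1 h2 *.
have -> : kap * (m * X) ^+ 2 = m * X ^+ 2 * (kap * m) by ring.
by rewrite kapE; lra.
Qed.

Variable phi : R -> R.
Hypothesis phi_lim : forall th, 0 <= th ->
  (fun b => progeny_pgf m 1 (expR (- (th * m ^- b))) b) @ \oo --> phi th.

Let mV th b : 0 <= th -> 0 <= th * m ^- b.
Proof. by move=> h; rewrite mulr_ge0 // invr_ge0 exprn_ge0 // ltW. Qed.

Let mK th b : m ^+ b * (th * m ^- b) = th.
Proof. by rewrite mulrCA divff ?mulr1 // expf_neq0 // gt_eqF. Qed.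

Lemma phi_ge th : 0 <= th -> 1 - th <= phi th.
Proof.
move=> th0; apply: (cvgr_to_ge (phi_lim th0)).
by apply: nearW => b; have := gw_pgf_ge b (mV b th0); rewrite mK.
Qed.

Lemma phi_le th : 0 <= th -> phi th <= 1 - th + kap * th ^+ 2.
Proof.
move=> th0; apply: (cvgr_to_le (phi_lim th0)).
by apply: nearW => b; have := gw_pgf_le b (mV b th0); rewrite mK.
Qed.

Lemma phi01 th : 0 <= th -> 0 <= phi th <= 1.
Proof.
move=> th0; apply/andP; split.
  apply: (cvgr_to_ge (phi_lim th0)).
  by apply: nearW => b; case/andP: (gw_pgf01 b (expRN01 (mV b th0))).
apply: (cvgr_to_le (phi_lim th0)).
by apply: nearW => b; case/andP: (gw_pgf01 b (expRN01 (mV b th0))).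
Qed.

Lemma phi_lip x y : 0 <= x -> 0 <= y -> `|phi x - phi y| <= `|x - y|.
Proof.
move=> x0 y0; have h : `|progeny_pgf m 1 (expR (- (x * m ^- b))) b -
      progeny_pgf m 1 (expR (- (y * m ^- b))) b| @[b --> \oo] --> `|phi x - phi y|.
  by apply: cvg_norm; apply: cvgB; exact: phi_lim.
apply: (cvgr_to_le h).
apply: nearW => b /=.
apply: le_trans (gw_pgf_lip _ (expRN01 (mV b x0)) (expRN01 (mV b y0))) _.
have M0 : 0 <= m ^+ b by rewrite exprn_ge0 // ltW.
have hx := mV b x0; have hy := mV b y0.
apply: le_trans (ler_wpM2l M0 (expR_lip _ _)) _; rewrite ?oppr_le0 //.
rewrite -{1}(ger0_norm M0) -normrM (_ : _ * _ = y - x) ?(distrC y) //.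
by rewrite mulrBr !mulrN !mK opprK addrC.
Qed.

(** The defining sequence at [m * th], shifted by one index, is the image under [poisson_pgf m] of
    the sequence at [th]. *)
Lemma phi_mul th : 0 <= th -> phi (m * th) = poisson_pgf m (phi th).
Proof.
move=> th0; have mth0 : 0 <= m * th by rewrite mulr_ge0 // ltW.
have h1 := phi_lim mth0; rewrite -cvg_shiftS /= in h1.
apply: (cvg_unique _ h1) => //.
have -> : (fun b => 1 * poisson_pgf m
      (iter b (fun s => 1 * poisson_pgf m s) (expR (- (m * th * m ^- b.+1))))) =
    (fun b => poisson_pgf m (progeny_pgf m 1 (expR (- (th * m ^- b))) b)).
  apply/funext => b; rewrite mul1r /progeny_pgf; congr (poisson_pgf m (iter b _ (expR (- _)))).
  by rewrite exprS invfM mulrACA mulfV ?mul1r // gt_eqF.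
apply: (@continuous_cvg _ _ _ _ _ _ (poisson_pgf m)); last exact: phi_lim.
rewrite /poisson_pgf.
apply: (@continuous_comp _ _ _ (fun s : R => - (m * (1 - s))) expR); last exact: continuous_expR.
apply: cvgN; apply: cvgM; first exact: cvg_cst.
apply: cvgB; [exact: cvg_cst|exact: cvg_id].
Qed.

Lemma phi_expn th b : 0 <= th -> phi (m ^+ b * th) = progeny_pgf m 1 (phi th) b.
Proof.
move=> th0; elim: b => [|b IH]; first by rewrite expr0 mul1r.
rewrite exprS -mulrA phi_mul ?mulr_ge0 ?exprn_ge0 ?(ltW m0) // IH /=.
by rewrite mul1r.
Qed.

(** Both terms are the b-th iterate, started at [expR (- c)] and at [phi c]. These agree to first
    order, and the iterate has Lipschitz constant [m ^+ b]. *)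
Lemma gw_pgf_phi c b : 0 <= c ->
  `|progeny_pgf m 1 (expR (- c)) b - phi (m ^+ b * c)| <= m ^+ b * (kap * c ^+ 2).
Proof.
move=> c0; rewrite phi_expn //.
apply: le_trans (gw_pgf_lip _ (expRN01 c0) (phi01 c0)) _.
have M0 : 0 <= m ^+ b by rewrite exprn_ge0 // ltW.
apply: ler_wpM2l => //.
have h1 := expRN_ge c; have h2 := expRN_le c0; have h3 := phi_ge c0.
have h4 := phi_le c0; have h5 : c ^+ 2 <= kap * c ^+ 2 by rewrite ler_peMl // sqr_ge0.
by rewrite ler_norml; apply/andP; split; lra.
Qed.

(* Subtracting [eps = a / (m - 1)] turns the recursion of the total progeny into
   that of the generation sizes up to a second order term. *)
Lemma total_pgf_phi a b : 0 <= a ->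
  `|progeny_pgf m (expR (- a)) (expR (- a)) b - phi (a * (m ^+ b.+1 / (m - 1)))|
    <= 2 * kap ^+ 3 * b.+1%:R * m ^+ b * a ^+ 2 + kap * a.
Proof.
move=> a0; pose eps := (kap - 1) * a.
have epsE : a / (m - 1) = eps.
  by rewrite /eps /kap; field; rewrite subr_eq0 gt_eqF.
have eps0 : 0 <= eps by rewrite mulr_ge0 // subr_ge0.
have epsa : eps <= kap * a by rewrite ler_wpM2r // lerBlDr lerDl.
have meps : m * eps = kap * a.
  by rewrite /eps mulrA mulrBr mulr1 (mulrC m) kapE addrK.
have ka0 : 0 <= kap * a by rewrite mulr_ge0.
have t01 := expRN01 a0.
set F := progeny_pgf m (expR (- a)) (expR (- a)).
have F01 i : 0 <= F i <= 1 by apply: progeny_pgf01.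
have Fx i : 1 - F i <= kap * a * m ^+ i.
  case/andP: t01 => t0 t1.
  have := @progeny_pgf_ge' R m m1 (expR (- a)) (expR (- a)) i.
  rewrite lexx t0 => /(_ isT t1) h; apply: le_trans h _.
  rewrite (mulrC kap a) -(mulrA a); apply: ler_wpM2r.
    by rewrite mulr_ge0 // exprn_ge0 // ltW.
  by have := expRN_ge a; lra.
(* The starting point matches [F 0 - eps] to first order, since a + eps = kap a. *)
pose G i := progeny_pgf m 1 (phi (kap * a)) i.
have G01 i : 0 <= G i <= 1 by apply: gw_pgf01; exact: phi01.
have GE : phi (a * (m ^+ b.+1 / (m - 1))) = G b.
  rewrite /G -phi_expn //; congr phi.
  by rewrite -meps -epsE exprS; ring.
have D i : `|F i - eps - G i| <= (kap ^+ 3 + 2 * kap ^+ 2 * i%:R) * m ^+ i * a ^+ 2.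
  elim: i => [|i IH].
    rewrite /F /G /= expr0 mulr0 addr0 mulr1.
    have h1 := expRN_ge a; have h2 := expRN_le a0; have h3 := phi_ge ka0.
    have h4 := phi_le ka0.
    have h5 : a ^+ 2 <= kap ^+ 3 * a ^+ 2.
      by rewrite ler_peMl ?sqr_ge0 // exprn_ege1.
    have -> : expR (- a) - eps = expR (- a) + a - kap * a by rewrite /eps; ring.
    have h6 : kap * (kap * a) ^+ 2 = kap ^+ 3 * a ^+ 2 by ring.
    by rewrite h6 in h4; rewrite ler_norml; apply/andP; split; lra.
  (* Exact because m eps = a + eps; this equation determines [eps]. Subtracting [eps] instead of
     multiplying by [expR (- eps)] costs at most of order eps (1 - F) + eps^2, which is [s1]. *)
  have FE : F i.+1 * expR (- eps) = poisson_pgf m (F i - eps).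
    rewrite /F /= -/(F i) /poisson_pgf -!expRD; congr expR.
    have : m * eps = a + eps by rewrite meps /eps; ring.
    by move=> e; transitivity (- (m * (1 - F i)) - m * eps); [rewrite e|]; ring.
  have GS : G i.+1 = poisson_pgf m (G i) by rewrite /G /= mul1r.
  rewrite GS (le_trans (ler_distD (F i.+1 * expR (- eps)) _ _)) //.
  have M1 : 1 <= m ^+ i.+1 by rewrite exprn_ege1 // ltW.
  have s1 : `|F i.+1 - eps - F i.+1 * expR (- eps)| <= 2 * kap ^+ 2 * m ^+ i.+1 * a ^+ 2.
    have /andP[f0 f1] := F01 i.+1; have fx := Fx i.+1.
    have e1 := expRN_ge eps; have e2 := expRN_le eps0.
    have u1 : F i.+1 * (1 - expR (- eps)) <= eps.
      have := ler_piMl eps0 f1; have : F i.+1 * (1 - expR (- eps)) <= F i.+1 * eps.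
        by apply: ler_wpM2l => //; lra.
      lra.
    have u2 : eps * F i.+1 - F i.+1 * eps ^+ 2 <= F i.+1 * (1 - expR (- eps)).
      rewrite (mulrC eps) -mulrBr; apply: ler_wpM2l => //; lra.
    have u3 : F i.+1 * eps ^+ 2 <= eps ^+ 2 by rewrite ler_piMl // sqr_ge0.
    have u4 : eps * (1 - F i.+1) <= kap * a * (kap * a * m ^+ i.+1).
      by rewrite ler_pM // subr_ge0.
    have u5 : eps ^+ 2 <= kap * a * (kap * a * m ^+ i.+1).
      by rewrite expr2 ler_pM // (le_trans epsa) // ler_peMr.
    have u6 : 2 * kap ^+ 2 * m ^+ i.+1 * a ^+ 2 = 2 * (kap * a * (kap * a * m ^+ i.+1)).
      by ring.
    by rewrite u6 ler_norml; apply/andP; split; lra.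
  have s2 : `|F i.+1 * expR (- eps) - poisson_pgf m (G i)| <=
      m * ((kap ^+ 3 + 2 * kap ^+ 2 * i%:R) * m ^+ i * a ^+ 2).
    rewrite FE; apply: le_trans (poisson_pgf_lip m1 _ _) _.
    - by case/andP: (F01 i) => _ h; lra.
    - by case/andP: (G01 i).
    by apply: ler_wpM2l => //; exact: ltW.
  apply: le_trans (lerD s1 s2) _; rewrite le_eqVlt; apply/orP; left; apply/eqP.
  by rewrite ![m ^+ i.+1]exprS -natr1; ring.
rewrite GE; have := D b => Db.
rewrite (_ : F b - G b = (F b - eps - G b) + eps); last by ring.
apply: le_trans (ler_normD _ _) _; apply: lerD; last by rewrite ger0_norm.
apply: le_trans Db _; rewrite -!(mulrA _ (m ^+ b) (a ^+ 2)).
apply: ler_wpM2r; first by rewrite mulr_ge0 ?sqr_ge0 // exprn_ge0 // ltW.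
rewrite -natr1; have h : kap ^+ 2 * b%:R <= kap ^+ 3 * b%:R.
  by rewrite ler_wpM2r // [leRHS]exprS ler_peMl // exprn_ge0.
have : 0 <= kap ^+ 3 by exact: exprn_ge0.
by move=> h'; lra.
Qed.

End LimitTransform.

(** * From the distance probability to [phi] *)

Section Combination.
Variables (R : realType) (m : R) (n : nat).
Hypotheses (m1 : 1 < m) (mn2 : 2 * m <= n%:R).
Let kap := m / (m - 1).
Let p := m / n%:R.
Let q := 1 - p.
Let lam := - ln q.
Implicit Types (t r s x c w : R).

Let m0 : 0 < m. Proof. exact: lt_trans m1. Qed.

Let mn : m <= n%:R.
Proof. by apply: le_trans mn2; move: m0; lra. Qed.

Let n0 : (0 : R) < n%:R. Proof. by apply: lt_le_trans mn. Qed.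

Let n1 : (0 < n)%N. Proof. by rewrite -(ltr_nat R). Qed.

Let kapE : kap * m = kap + m.
Proof. by rewrite /kap; field; rewrite subr_eq0 gt_eqF. Qed.

Let kap1 : 1 <= kap.
Proof. by rewrite /kap ler_pdivlMr ?subr_gt0 // mul1r gerBl. Qed.

Let k0 : 0 <= kap. Proof. by apply: le_trans kap1. Qed.

Let p0 : 0 < p. Proof. by rewrite /p divr_gt0. Qed.

Let p2 : p <= 2^-1.
Proof. by rewrite /p ler_pdivrMr // mulrC ler_pdivlMr // mulrC. Qed.

Let q0 : 0 < q. Proof. by rewrite /q; move: p2; lra. Qed.

Let q01 : 0 <= q <= 1.
Proof. by rewrite (ltW q0) /= /q; move: p0; lra. Qed.

Let q_lam : expR (- lam) = q.
Proof. by rewrite /lam opprK lnK. Qed.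

Let lam_ge : p <= lam.
Proof.
have : ln (1 + - p) <= - p by apply: le_ln1Dx; move: p2; lra.
by rewrite /lam /q; lra.
Qed.

(** [lam] makes [q ^+ x] an exact exponential; replacing it by [p] at the end costs only second
    order, because -ln q <= p / q and [p <= 1/2]. *)
Let lam_le : lam <= p + 2 * p ^+ 2.
Proof.
have e : lam = ln (1 + p / q).
  by rewrite /lam -lnV ?posrE //; congr ln; rewrite /q; field; rewrite -/q gt_eqF.
rewrite e; apply: (@le_trans _ _ (p / q)).
  by apply: le_ln1Dx; apply: lt_trans (_ : 0 < _); rewrite ?ltrN10 // divr_gt0.
rewrite ler_pdivrMr // /q; have h := ler_wpM2l (sqr_ge0 p) p2.
rewrite -subr_ge0 (_ : _ - _ = 2 * (p ^+ 2 * 2^-1 - p ^+ 2 * p)); last by field.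
by rewrite mulr_ge0 // subr_ge0.
Qed.

Let lam2 : lam <= 2 * p.
Proof.
apply: le_trans lam_le _; have := ler_wpM2l (ltW p0) p2.
rewrite -expr2; lra.
Qed.

Let lam0 : 0 <= lam. Proof. by rewrite (le_trans (ltW p0)). Qed.

Let q_pow (x : nat) : q ^+ x = expR (- (lam * x%:R)).
Proof. by rewrite -q_lam -expRM_natr mulNr. Qed.

Let qJ_le J : 1 - q ^+ J <= J%:R * p.
Proof. exact: infection_le. Qed.

Let qJ01 J : 0 <= q ^+ J <= 1.
Proof. by case/andP: q01 => a b; rewrite exprn_ge0 //= exprn_ile1. Qed.

Variables b j : nat.
Let M := m ^+ b.
Let Mj := m ^+ j.

Local Notation E k g S0 := (iter k (rf_step q) g 0%N S0 1%N).

(** Generating function of the size of the ball of radius b around one vertex among [S] others. *)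
Let Y t S := E b (fun a _ J => t ^+ a * t ^+ J) S.

Let M1 : 1 <= M. Proof. by rewrite /M exprn_ege1 // ltW. Qed.
Let Mj1 : 1 <= Mj. Proof. by rewrite /Mj exprn_ege1 // ltW. Qed.
Let M0 : 0 <= M. Proof. exact: le_trans M1. Qed.
Let Mj0 : 0 <= Mj. Proof. exact: le_trans Mj1. Qed.

Let kap_exp i l : (i <= l)%N -> kap ^+ i <= kap ^+ l.
Proof. by move=> il; rewrite ler_weXn2l. Qed.

Let Y_pgf t S : 0 <= t <= 1 -> (S <= n)%N ->
  `|Y t S - progeny_pgf m t t b| <=
  2 * (1 - t) / n%:R * (2 * kap ^+ 4 * M ^+ 2 + kap * b%:R * M * (n%:R - S%:R)).
Proof.
move=> /andP[t0 t1] Sn; have tt : 0 <= t <= t by rewrite t0 lexx.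
have := rf_progeny_pgf m1 mn b 0 1 tt t1 Sn.
rewrite !expr0 !mul1r expr1n !mulr1 expr1; move/le_trans; apply.
apply: ler_wpM2l; first by rewrite divr_ge0 ?(ltW n0) // mulr_ge0 // subr_ge0.
rewrite lerD2r -/M -/kap; have := ler_wpM2r (sqr_ge0 M) (kap_exp (isT : 3 <= 4)%N).
lra.
Qed.

Let Y01 t S : 0 <= t <= 1 -> 0 <= Y t S <= 1.
Proof.
move=> /andP[t0 t1]; apply/andP; split.
  rewrite -[leLHS](rf_cst q b 0 0 S 1); apply: ler_rf => // a S' J _ _.
  by rewrite mulr_ge0 // exprn_ge0.
rewrite -[leRHS](rf_cst q b 1 0 S 1); apply: ler_rf => // a S' J _ _.
by rewrite mulr_ile1 // ?exprn_ge0 ?exprn_ile1.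
Qed.

Let pred_le : (n.-1 <= n)%N. Proof. exact: leq_pred. Qed.

Let natn : (n.-1 + 1 = n)%N. Proof. by rewrite addn1 prednK. Qed.

Let nolinkY I S : nolink q b S 1 I = Y (q ^+ I) S.
Proof. by have := nolink_rf q b 0 S 1 I; rewrite expr0 mul1r => <-. Qed.

(* The ball around the second vertex may be grown among [n] fresh vertices rather
   than among those left over by the first exploration. *)
Lemma two_sided :
  `|n%:R^-1 * E (j + b.+1) (fun _ S _ => S%:R) n.-1
     - E j (fun _ _ J => Y (q ^+ J) n) n.-1| <=
  kap * Mj / n%:R +
  2 * m / n%:R ^+ 2 * (4 * kap ^+ 4 * M ^+ 2 * Mj + 2 * kap ^+ 3 * b%:R * M * Mj ^+ 2).
Proof.
rewrite iterD.
(* Duality enters here: an exploration from J frontier vertices becomes one from the single second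
   vertex, evaluated at [q ^+ J]. *)
have -> : iter b.+1 (rf_step q) (fun _ S _ => S%:R) =
    fun a S J => S%:R * Y (q ^+ J) S.-1.
  apply/funext => a; apply/funext => S; apply/funext => J.
  by rewrite rf_unreached nolink_sym nolinkY.
rewrite -(rfZ q01).
pose w0 : R := 2 * p / n%:R.
have w00 : 0 <= w0 by rewrite /w0 divr_ge0 ?(ltW n0) // mulr_ge0 // ltW.
pose e (a S J : nat) : R := n%:R^-1 * (a + J)%N%:R +
  (w0 * (4 * kap ^+ 4 * M ^+ 2) * J%:R +
   w0 * (kap * b%:R * M) * (J%:R * (a + J)%N%:R + J%:R)).
have B0 : 0 <= kap * b%:R * M by rewrite ?(k0, M0, mulr_ge0).
apply: (@le_trans _ _ (E j e n.-1)).
  apply: (rf_dist q01) => a S J Sn1 ajs0.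
  have ajs : (a + J + S = n)%N by rewrite ajs0 add0n add1n prednK.
  have Sn : (S <= n)%N by exact: leq_trans Sn1 pred_le.
  have S1n : (S.-1 <= n)%N by exact: leq_trans (leq_pred _) Sn.
  have t01 := qJ01 J; set t := q ^+ J in t01 *.
  have y1 := Y_pgf t01 S1n; have y2 := Y_pgf t01 (leqnn n).
  have /andP[z0 z1] := Y01 S.-1 t01.
  have SE : (S%:R : R) = n%:R - (a + J)%N%:R by rewrite -ajs addnC natrD; ring.
  (* Both [Y t S.-1] and [Y t n] are compared with the same branching generating function; the last
     term is the loss from replacing S / n by 1. *)
  rewrite (_ : _ - _ = (Y t S.-1 - progeny_pgf m t t b) -
    (Y t n - progeny_pgf m t t b) - n%:R^-1 * (a + J)%N%:R * Y t S.-1); last first.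
    by rewrite SE; field; rewrite gt_eqF.
  rewrite (le_trans (ler_normB _ _)) // addrC lerD //.
    rewrite ger0_norm; last by rewrite mulr_ge0 // mulr_ge0 // invr_ge0 ltW.
    by rewrite ler_piMr // mulr_ge0 // invr_ge0 ltW.
  apply: le_trans (ler_normB _ _) _; apply: le_trans (lerD y1 y2) _.
  rewrite subrr mulr0 addr0 -mulrDr.
  have tJ : 2 * (1 - t) / n%:R <= w0 * J%:R.
    rewrite (_ : w0 * J%:R = 2 * (J%:R * p) / n%:R); last by rewrite /w0; ring.
    by rewrite ler_wpM2r ?invr_ge0 ?(ltW n0) // ler_wpM2l // qJ_le.
  have nS : n%:R - S.-1%:R <= (a + J)%N%:R + 1 :> R.
    by rewrite lerBlDr natr1 -natrD ler_nat -[X in (X <= _)%N]ajs addSnnS leq_add2l leqSpred.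
  have nS0 : 0 <= n%:R - S.-1%:R :> R by rewrite subr_ge0 ler_nat.
  apply: (@le_trans _ _ (w0 * J%:R * (4 * kap ^+ 4 * M ^+ 2 + kap * b%:R * M * ((a + J)%N%:R + 1)))).
    apply: ler_pM => //.
    - rewrite divr_ge0 ?(ltW n0) // mulr_ge0 // subr_ge0; by case/andP: t01.
    - have K4 := exprn_ge0 4 k0.
      by rewrite ?(K4, B0, nS0, sqr_ge0, mulr_ge0, addr_ge0).
    - have := ler_wpM2l B0 nS; lra.
  by rewrite le_eqVlt; apply/orP; left; apply/eqP; ring.
rewrite /e !(rfD q01) !(rfZ q01) (rfD q01).
have hy := E_y m1 mn pred_le j; have hJ := E_J m1 mn pred_le j.
have hJy := E_Jy m1 mn pred_le j.
rewrite -/kap -/Mj in hy hJ hJy; rewrite -/p -/q in hy hJ hJy.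
have K4 := exprn_ge0 4 k0.
have c1 : 0 <= w0 * (4 * kap ^+ 4 * M ^+ 2) by rewrite ?(w00, K4, sqr_ge0, mulr_ge0).
have c2 : 0 <= w0 * (kap * b%:R * M) by rewrite mulr_ge0.
have hy' : n%:R^-1 * E j (fun a _ J => (a + J)%N%:R) n.-1 <= kap * Mj / n%:R.
  rewrite mulrC ler_wpM2r ?invr_ge0 ?(ltW n0) // (le_trans hy) // gerBl subr_ge0 //.
have hJy' : E j (fun a _ J => J%:R * (a + J)%N%:R) n.-1 + E j (fun _ _ J => J%:R) n.-1
    <= 2 * kap ^+ 2 * Mj ^+ 2.
  apply: le_trans (lerD hJy hJ) _.
  have u1 : Mj <= Mj ^+ 2 by rewrite expr2 ler_peMr.
  have u2 : Mj ^+ 2 <= kap ^+ 2 * Mj ^+ 2 by rewrite ler_peMl ?sqr_ge0 // exprn_ege1.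
  lra.
rewrite lerD //; apply: le_trans (lerD (ler_wpM2l c1 hJ) (ler_wpM2l c2 hJy')) _.
by rewrite le_eqVlt /w0 /p; apply/orP; left; apply/eqP; field; rewrite gt_eqF.
Qed.

Variable phi : R -> R.
Hypothesis phi_lim : forall th, 0 <= th ->
  (fun b => progeny_pgf m 1 (expR (- (th * m ^- b))) b) @ \oo --> phi th.

(** The two chains are now independent and can be exchanged. With the ball size [x] of the b-chain
    fixed, the j-chain contributes the generating function of generation j at
    [q ^+ x = expR (- (lam x))], hence approximately [phi (m^j lam x)]. The errors are linear and
    quadratic in [x], whence [E_y] and [E_yy]. *)
Lemma one_side_phi :
  `|E j (fun _ _ J => Y (q ^+ J) n) n.-1 -
    E b (fun a _ J => phi (Mj * (lam * (a + J)%N%:R))) n| <=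
  6 * kap ^+ 5 * m * M * Mj ^+ 2 / n%:R ^+ 2 + 12 * kap ^+ 4 * m ^+ 2 * Mj * M ^+ 2 / n%:R ^+ 2.
Proof.
rewrite /Y (rf_exchange q01).
pose e (a S J : nat) : R :=
   6 * kap ^+ 4 * Mj ^+ 2 * p / n%:R * (a + J)%N%:R + Mj * kap * lam ^+ 2 * (a + J)%N%:R ^+ 2.
have K4 := exprn_ge0 4 k0.
apply: (@le_trans _ _ (E b e n)).
  apply: (rf_dist q01) => a S J _ _; set x := (a + J)%N.
  have -> : (fun (b0 T : nat) (K : nat) => (q ^+ K) ^+ a * (q ^+ K) ^+ J) =
      (fun b0 T K : nat => 1 ^+ b0 * (q ^+ x) ^+ K).
    apply/funext => b0; apply/funext => T; apply/funext => K.
    by rewrite -exprD -!exprM mulnC expr1n mul1r.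
  have t01 := qJ01 x; have := rf_progeny_pgf m1 mn j 0 1 (r := 1) t01 (lexx 1) pred_le.
  rewrite !expr0 !mul1r expr1n !mulr1 expr1 -/p -/q -/Mj -/kap => h1.
  have h2 := gw_pgf_phi m1 phi_lim j (_ : 0 <= lam * x%:R).
  rewrite mulr_ge0 // in h2; move: h2 => /(_ isT); rewrite -q_pow -/Mj -/kap => h2.
  rewrite (le_trans (ler_distD (progeny_pgf m 1 (q ^+ x) j) _ _)) // /e -/x.
  rewrite lerD //; last first.
    by apply: le_trans h2 _; rewrite exprMn !mulrA.
  apply: le_trans h1 _.
  have -> : n%:R - n.-1%:R = 1 :> R by rewrite -{1}natn natrD; ring.
  rewrite mulr1.
  (* Bernoulli's inequality absorbs the factor j, so no logarithm arises on this side. *)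
  have jle : kap * j%:R * Mj <= kap ^+ 4 * Mj ^+ 2.
    have jM : j%:R <= kap * Mj.
      have : 1 + j%:R * (m - 1) <= Mj.
        rewrite /Mj; elim: (j) => [|i IH]; first by rewrite mul0r addr0 expr0.
        rewrite exprS -natr1; have := ler_wpM2l (ltW m0) IH.
        have : 0 <= i%:R * (m - 1) ^+ 2 by rewrite mulr_ge0 ?sqr_ge0.
        by lra.
      move=> h; have h' : kap * (1 + j%:R * (m - 1)) <= kap * Mj by apply: ler_wpM2l.
      apply: le_trans h'; rewrite mulrDr mulr1 mulrCA.
      rewrite (_ : kap * (m - 1) = m); last by rewrite mulrBr kapE; ring.
      have : j%:R <= j%:R * m by rewrite ler_peMr // ltW.
      move: k0; lra.
    apply: (@le_trans _ _ (kap * (kap * Mj) * Mj)).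
      by apply: ler_wpM2r => //; apply: ler_wpM2l.
    rewrite (_ : _ * _ = kap ^+ 2 * Mj ^+ 2); last by ring.
    by apply: ler_wpM2r; rewrite ?sqr_ge0 ?kap_exp.
  have k34 : kap ^+ 3 * Mj ^+ 2 <= kap ^+ 4 * Mj ^+ 2.
    by apply: ler_wpM2r; rewrite ?sqr_ge0 ?kap_exp.
  apply: (@le_trans _ _ (2 * (x%:R * p) / n%:R * (3 * kap ^+ 4 * Mj ^+ 2))).
    apply: ler_pM.
    - by rewrite divr_ge0 ?(ltW n0) // mulr_ge0 // subr_ge0; case/andP: t01.
      by rewrite ?(K4, exprn_ge0 3 k0, k0, Mj0, sqr_ge0, mulr_ge0, addr_ge0).
    - by rewrite ler_wpM2r ?invr_ge0 ?(ltW n0) // ler_wpM2l.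
    - by lra.
  by rewrite le_eqVlt; apply/orP; left; apply/eqP; ring.
rewrite /e (rfD q01) !(rfZ q01).
have hy := E_y m1 mn (leqnn n) b; have hyy := E_yy m1 mn (leqnn n) b.
rewrite -/kap -/M -/p -/q in hy hyy.
have hy' : E b (fun a _ J => (a + J)%N%:R) n <= kap * M.
  by rewrite (le_trans hy) // gerBl subr_ge0.
have c1 : 0 <= 6 * kap ^+ 4 * Mj ^+ 2 * p / n%:R.
  by rewrite divr_ge0 ?(ltW n0) // ?(K4, ltW p0, sqr_ge0, mulr_ge0).
have c2 : 0 <= Mj * kap * lam ^+ 2 by rewrite ?(Mj0, k0, sqr_ge0, mulr_ge0).
rewrite lerD //.
  apply: le_trans (ler_wpM2l c1 hy') _.
  by rewrite le_eqVlt /p; apply/orP; left; apply/eqP; field; rewrite gt_eqF.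
apply: le_trans (ler_wpM2l c2 hyy) _.
have l2 : lam ^+ 2 <= 4 * (m / n%:R) ^+ 2.
  rewrite (_ : 4 * _ = (2 * p) ^+ 2); last by rewrite /p; ring.
  by rewrite lerXn2r // nnegrE // mulr_ge0 // ltW.
have c3 : 0 <= Mj * kap * (3 * kap ^+ 3 * M ^+ 2).
  by rewrite ?(Mj0, k0, exprn_ge0 3 k0, sqr_ge0, M0, mulr_ge0).
have := ler_wpM2l c3 l2; set L := lam ^+ 2.
rewrite (_ : Mj * kap * L * _ = Mj * kap * (3 * kap ^+ 3 * M ^+ 2) * L); last by ring.
move=> h; apply: le_trans h _.
by rewrite le_eqVlt; apply/orP; left; apply/eqP; field; rewrite gt_eqF.
Qed.

(** Here [phi] has been written as an average of exponentials and the value [w] of W fixed, so the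
    b-chain appears through its total progeny at [expR (- a)]. Three errors follow: chain to
    branching process, total progeny to [phi], and [lam] to [p]. *)
Lemma mixture_phi w : 0 <= w ->
  `|E b (fun a _ J => expR (- (Mj * (lam * (a + J)%N%:R) * w))) n -
    phi (p * Mj * kap * M * w)| <=
  (8 * kap ^+ 4 * m * M ^+ 2 * Mj / n%:R ^+ 2 + 2 * kap * m * Mj / n%:R +
    2 * kap * m ^+ 2 * M * Mj / n%:R ^+ 2) * w
  + 8 * kap ^+ 3 * m ^+ 2 * b.+1%:R * M * Mj ^+ 2 / n%:R ^+ 2 * w ^+ 2.
Proof.
move=> w0; pose a := Mj * lam * w.
have a0 : 0 <= a by rewrite /a ?(Mj0, lam0, w0, mulr_ge0).
have t01 : 0 <= expR (- a) <= 1 by rewrite expR_ge0 expR_le1 oppr_le0.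
have -> : (fun i (_ J : nat) => expR (- (Mj * (lam * (i + J)%N%:R) * w))) =
    (fun i (_ : nat) J => expR (- a) ^+ i * expR (- a) ^+ J).
  apply/funext => i; apply/funext => S; apply/funext => J.
  by rewrite -exprD -expRM_natr /a; congr expR; ring.
have ale : a <= Mj * (2 * p) * w.
  by rewrite /a; apply: ler_wpM2r => //; apply: ler_wpM2l.
have h1 := Y_pgf t01 (leqnn n); rewrite subrr mulr0 addr0 in h1.
have h2 := total_pgf_phi m1 phi_lim b a0; rewrite -/kap -/M in h2.
have cE : m ^+ b.+1 / (m - 1) = kap * M by rewrite exprS /kap /M; ring.
rewrite cE in h2.
have c0 : 0 <= Mj * w * (kap * M) by rewrite ?(Mj0, w0, k0, M0, mulr_ge0).
have h3 : `|phi (a * (kap * M)) - phi (p * Mj * kap * M * w)| <= 2 * p ^+ 2 * (Mj * w * (kap * M)).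
  have e1 : a * (kap * M) = lam * (Mj * w * (kap * M)) by rewrite /a; ring.
  have e2 : p * Mj * kap * M * w = p * (Mj * w * (kap * M)) by ring.
  rewrite e1 e2; apply: le_trans (phi_lip m1 phi_lim _ _) _.
  - exact: mulr_ge0.
  - by apply: mulr_ge0 => //; exact: ltW.
  rewrite -mulrBl normrM (ger0_norm c0) ger0_norm ?subr_ge0 //.
  by apply: ler_wpM2r => //; move: lam_le; lra.
rewrite -/(Y (expR (- a)) n).
rewrite (le_trans (ler_distD (progeny_pgf m (expR (- a)) (expR (- a)) b) _ _)) //.
apply: le_trans (lerD h1 (le_trans (ler_distD (phi (a * (kap * M))) _ _) (lerD h2 h3))) _.
have K4 := exprn_ge0 4 k0; have K3 := exprn_ge0 3 k0.
have g1 : 2 * (1 - expR (- a)) / n%:R * (2 * kap ^+ 4 * M ^+ 2) <=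
    8 * kap ^+ 4 * m * M ^+ 2 * Mj / n%:R ^+ 2 * w.
  apply: (@le_trans _ _ (2 * (Mj * (2 * p) * w) / n%:R * (2 * kap ^+ 4 * M ^+ 2))).
    apply: ler_wpM2r; first by rewrite ?(K4, sqr_ge0, mulr_ge0).
    apply: ler_wpM2r; first by rewrite invr_ge0 ltW.
    apply: ler_wpM2l => //; apply: le_trans ale; have := expRN_ge a; lra.
  by rewrite le_eqVlt /p; apply/orP; left; apply/eqP; field; rewrite gt_eqF.
have g2 : 2 * kap ^+ 3 * b.+1%:R * M * a ^+ 2 <=
    8 * kap ^+ 3 * m ^+ 2 * b.+1%:R * M * Mj ^+ 2 / n%:R ^+ 2 * w ^+ 2.
  apply: (@le_trans _ _ (2 * kap ^+ 3 * b.+1%:R * M * (Mj * (2 * p) * w) ^+ 2)).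
    apply: ler_wpM2l; first by rewrite ?(K3, M0, ler0n, mulr_ge0).
    by rewrite lerXn2r // nnegrE // (le_trans a0).
  by rewrite le_eqVlt /p; apply/orP; left; apply/eqP; field; rewrite gt_eqF.
have g3 : kap * a <= 2 * kap * m * Mj / n%:R * w.
  apply: le_trans (ler_wpM2l k0 ale) _.
  by rewrite le_eqVlt /p; apply/orP; left; apply/eqP; field; rewrite gt_eqF.
have g4 : 2 * p ^+ 2 * (Mj * w * (kap * M)) = 2 * kap * m ^+ 2 * M * Mj / n%:R ^+ 2 * w.
  by rewrite /p; field; rewrite gt_eqF.
rewrite g4; lra.
Qed.

End Combination.

(** * The law of the branching process and of its limit *)

Section GaltonWatson.
Context (R : realType) (d : measure_display) (T : measurableType d).
Variables (P : probability T R) (m : R) (xi : nat * nat -> {RV P >-> nat}).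
Hypotheses (m0 : 0 < m) (iid : poisson_iid m xi).
Implicit Types (D : set T) (I : pred (nat * nat)).

(** Independence of one event from the offspring variables indexed by [I]. Since everything is
    integer valued, events can replace sigma-algebras: random sums are handled by partitioning
    according to values. *)
Definition indep_of D I := measurable D /\
  forall (s : seq (nat * nat)) (A : nat * nat -> set nat), uniq s -> all I s ->
    P (D `&` \big[setI/setT]_(i <- s) (xi i @^-1` A i)) =
    (P D * \prod_(i <- s) P (xi i @^-1` A i))%E.

Let mxi i (B : set nat) : measurable (xi i @^-1` B).
Proof. exact: measurable_funPTI. Qed.

Let mbig (s : seq (nat * nat)) (A : nat * nat -> set nat) :
  measurable (\big[setI/setT]_(i <- s) (xi i @^-1` A i)).
Proof. by apply: bigsetI_measurable => i _; exact: mxi. Qed.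

Let Pbig (s : seq (nat * nat)) (A : nat * nat -> set nat) : uniq s ->
  (\prod_(i <- s) P (xi i @^-1` A i))%E =
  P (\big[setI/setT]_(i <- s) (xi i @^-1` A i)).
Proof.
move=> us; case: iid => mi _; have := mi s A us (fun=> Logic.I).
by rewrite bigcap_seq => ->.
Qed.

Lemma indep_of_sub D I I' : {subset I' <= I} -> indep_of D I -> indep_of D I'.
Proof.
move=> II [mD h]; split=> // s A us sI; apply: h => //.
by apply: sub_all sI => x; exact: II.
Qed.

Lemma indep_of_setT I : indep_of setT I.
Proof.
split=> // s A us _.
by rewrite setTI probability_setT mul1e Pbig.
Qed.

Lemma indep_of_set0 I : indep_of set0 I.
Proof. by split=> // s A us _; rewrite set0I measure0 mul0e. Qed.

Lemma indep_of_setI D I i (B : set nat) : indep_of D I -> I i ->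
  P (D `&` xi i @^-1` B) = (P D * P (xi i @^-1` B))%E /\
  indep_of (D `&` xi i @^-1` B) [pred j | I j & j != i].
Proof.
move=> [mD h] Ii.
have h1 : P (D `&` xi i @^-1` B) = (P D * P (xi i @^-1` B))%E.
  have := h [:: i] (fun=> B) isT; rewrite /= Ii => /(_ isT).
  by rewrite !big_seq1.
split=> //; split=> [|s A us sI]; first exact: measurableI.
pose A' j := if j == i then B else A j.
have is_ : i \notin s.
  by apply/negP => /(allP sI) /=; rewrite eqxx andbF.
have A'E : \big[setI/setT]_(j <- s) (xi j @^-1` A' j) =
    \big[setI/setT]_(j <- s) (xi j @^-1` A j).
  apply: eq_big_seq => j js; rewrite /A'; case: eqVneq => // ji.
  by rewrite -ji js in is_.
have A'P : (\prod_(j <- s) P (xi j @^-1` A' j) = \prod_(j <- s) P (xi j @^-1` A j))%E.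
  apply: eq_big_seq => j js; rewrite /A'; case: eqVneq => // ji.
  by rewrite -ji js in is_.
have := h (i :: s) A'; rewrite /= is_ us Ii /= => /(_ isT).
rewrite !big_cons A'E A'P {1 2}/A' eqxx setIA => ->; last first.
  by apply: sub_all sI => j /andP[].
by rewrite h1 muleA.
Qed.

Lemma indep_of_bigcup (F : nat -> set T) I : (forall k, indep_of (F k) I) ->
  trivIset setT F -> indep_of (\bigcup_k F k) I.
Proof.
move=> hF tF; have mF k : measurable (F k) by case: (hF k).
split=> [|s A us sI]; first exact: bigcupT_measurable.
set C := \big[setI/setT]_(i <- s) _.
have mC : measurable C by exact: mbig.
have fC : P C \is a fin_num by exact: fin_num_measure.
have mFC k : measurable (F k `&` C) by exact: measurableI.
have -> : P (\bigcup_k F k `&` C) = (\sum_(0 <= k <oo) P (F k `&` C))%E.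
  rewrite setI_bigcupl measure_semi_bigcup //; last exact: bigcupT_measurable.
  exact: trivIset_setIr.
have -> : P (\bigcup_k F k) = (\sum_(0 <= k <oo) P (F k))%E.
  by rewrite measure_semi_bigcup //; exact: bigcupT_measurable.
rewrite Pbig // -/C.
rewrite muleC -(fineK fC) -nneseriesZl //; apply: eq_eseriesr => k _.
by case: (hF k) => _ /(_ s A us sI) ->; rewrite Pbig // muleC fineK.
Qed.

Lemma indep_of_addn D (Y : T -> nat) I i :
  (forall k, indep_of (D `&` [set w | Y w = k]) I) -> I i ->
  forall k, indep_of (D `&` [set w | (Y w + xi i w)%N = k]) [pred j | I j & j != i].
Proof.
move=> h Ii k.
(* The guard is needed because [k - c] is a truncated subtraction. *)
pose F c := (if (c <= k)%N then D `&` [set w | Y w = (k - c)%N] else set0)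
  `&` xi i @^-1` [set c].
have -> : D `&` [set w | (Y w + xi i w)%N = k] = \bigcup_c F c.
  apply/seteqP; split=> w.
    move=> [Dw /= Yk]; exists (xi i w) => //; rewrite /F -Yk leq_addl; split=> //.
    by split=> //=; rewrite addnK.
  move=> [c _ []]; case: ifP => [ck [Dw /= Yk] /= xc|_ []//].
  by split=> //=; rewrite Yk xc subnK.
apply: indep_of_bigcup.
  move=> c; rewrite /F; case: ifP => _.
    by have [] := indep_of_setI [set c] (h (k - c)%N) Ii.
  by rewrite set0I; exact: indep_of_set0.
move=> a b _ _ [w [[_ /= wa] [_ /= wb]]]; by rewrite -wa -wb.
Qed.

Lemma gw_partial_indep D q : indep_of D [pred x | q <= x.1]%N -> forall j k,
  indep_of (D `&` [set w | (\sum_(i < j) xi (q, val i) w)%N = k])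
    [pred x | (q < x.1) || (x.1 == q) && (j <= x.2)]%N.
Proof.
move=> h; elim=> [|j IH] k.
  have [->|k0] := eqVneq k 0%N.
    rewrite (_ : [set w | _] = setT) ?setIT; last first.
      by apply/seteqP; split=> w //= _; rewrite big_ord0.
    by apply: indep_of_sub h => x /=; rewrite !inE /=; lia.
  rewrite (_ : [set w | _] = set0) ?setI0; last first.
    by apply/seteqP; split=> w //=; rewrite big_ord0 => k0'; rewrite -k0' in k0.
  exact: indep_of_set0.
rewrite (_ : [set w | _] = [set w | ((\sum_(i < j) xi (q, val i) w) + xi (q, j) w)%N = k]); last first.
  by apply/seteqP; split=> w /=; rewrite big_ord_recr.
have Ij : [pred x | (q < x.1) || (x.1 == q) && (j <= x.2)]%N (q, j).
  by rewrite /= eqxx leqnn orbT.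
apply: indep_of_sub (indep_of_addn IH Ij k) => -[x y].
by rewrite !inE /= xpair_eqE; lia.
Qed.

(** On the event that generation q has l members, the next size is a sum of l fixed variables of row
    q, to which [gw_partial_indep] applies; only the later rows remain available. *)
Lemma bgw_indep q k : indep_of [set w | bgw xi q w = k] [pred x | q <= x.1]%N.
Proof.
elim: q k => [|q IH] k.
  have [<-|k1] := eqVneq 1%N k.
    rewrite (_ : [set w | _] = setT); first exact: indep_of_setT.
    by apply/seteqP.
  rewrite (_ : [set w | _] = set0); first exact: indep_of_set0.
  by apply/seteqP; split=> w //= k1'; rewrite k1' eqxx in k1.
pose F l := [set w | bgw xi q w = l] `&` [set w | (\sum_(i < l) xi (q, val i) w)%N = k].
have -> : [set w | bgw xi q.+1 w = k] = \bigcup_l F l.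
  apply/seteqP; split=> w /=; first by move=> h; exists (bgw xi q w).
  by move=> [l _ [/= -> ]].
apply: indep_of_bigcup.
  move=> l; apply: indep_of_sub (gw_partial_indep (IH l) l k) => x.
  by rewrite !inE => ->.
by move=> a b _ _ [w [[/= <- _] [/= <- _]]].
Qed.

Lemma measurable_bgw q : measurable_fun setT (fun w => bgw xi q w).
Proof.
move=> _ Y _; rewrite setTI.
have -> : (fun w => bgw xi q w) @^-1` Y =
    \bigcup_(k in Y) [set w | bgw xi q w = k].
  apply/seteqP; split=> [w Yw|w [k Yk /= e]]; first by exists (bgw xi q w).
  by rewrite /preimage /= e.
by apply: bigcup_measurable => k _; case: (bgw_indep q k).
Qed.

Lemma poisson_series (s : R) : 0 <= s ->
  (\sum_(0 <= k <oo) (poisson_pmf m k * s ^+ k)%:E = (poisson_pgf m s)%:E)%E.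
Proof.
move=> s0.
have -> : poisson_pgf m s = expR (- m) * expR (m * s).
  by rewrite -expRD; congr expR; ring.
transitivity (\sum_(0 <= k <oo) ((expR (- m))%:E * ((m * s) ^+ k / k`!%:R)%:E))%E.
  by apply: eq_eseriesr => k _; rewrite /poisson_pmf m0 -EFinM exprMn; congr EFin; ring.
rewrite nneseriesZl/=; last first.
  by move=> k _; rewrite lee_fin divr_ge0// exprn_ge0// mulr_ge0 // ltW.
rewrite EFinM; congr *%E; rewrite expRE -EFin_lim; last first.
  rewrite /pseries/=; under eq_fun do rewrite mulrC.
  exact: is_cvg_series_exp_coeff.
apply/congr_lim/funext => k/=; rewrite /pseries/= /series/= -sumEFin//.
by under eq_bigr do rewrite mulrC.
Qed.

Let mfun_nat (h : nat -> R) (f : T -> nat) : measurable_fun setT f ->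
  measurable_fun setT ((fun w => (h (f w))%:E) : T -> \bar R).
Proof.
move=> mf; apply/measurable_EFinP.
by apply: (@measurableT_comp _ _ _ _ _ _ h) => // _ Y _; exact: Logic.I.
Qed.

Let measurable_sumn q j l : measurable_fun setT (fun w : T => (\sum_(i < l) xi (q, (j + i)%N) w)%N).
Proof.
elim: l => [|l IH].
  by rewrite (_ : (fun w => _) = cst 0%N) //; apply/funext => w; rewrite big_ord0.
rewrite (_ : (fun w => _) = (fun w => (\sum_(i < l) xi (q, (j + i)%N) w) + xi (q, (j + l)%N) w)%N).
  move=> _ Y _; rewrite setTI.
  rewrite (_ : _ @^-1` _ = \bigcup_k
    ((fun w => (\sum_(i < l) xi (q, (j + i)%N) w)%N) @^-1` [set k] `&`
     (xi (q, (j + l)%N) @^-1` [set c | Y (k + c)%N]))).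
    apply: bigcupT_measurable => k; apply: measurableI => //.
    by rewrite -[X in measurable X]setTI; exact: IH.
  apply/seteqP; split=> w /=.
    by move=> Yw; exists (\sum_(i < l) xi (q, (j + i)%N) w)%N.
  by move=> [k _ /= [-> ]].
by apply/funext => w; rewrite big_ord_recr.
Qed.

(** The first sibling is conditioned on its value c and absorbed into the event, which stays
    independent of the later siblings; hence the induction generalizes over [D] and [j]. *)
Lemma integral_sibs (s : R) D q j l : 0 <= s <= 1 ->
  indep_of D [pred x | (x.1 == q) && (j <= x.2)%N] ->
  (\int[P]_(w in D) (s ^+ (\sum_(i < l) xi (q, (j + i)%N) w)%N)%:E =
    P D * (poisson_pgf m s ^+ l)%:E)%E.
Proof.
move=> /andP[s0 s1]; elim: l D j => [|l IH] D j hD.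
  case: (hD) => mD _; under eq_integral do rewrite big_ord0 expr0.
  by rewrite integral_cst // mul1e expr0 mule1.
have mD : measurable D by case: hD.
pose F c := D `&` xi (q, j) @^-1` [set c].
have Ij : [pred x | (x.1 == q) && (j <= x.2)%N] (q, j) by rewrite /= eqxx leqnn.
have DE : D = \bigcup_c F c.
  apply/seteqP; split=> w; last by move=> [c _ []].
  by move=> Dw; exists (xi (q, j) w).
have f0 : 0 <= poisson_pgf m s by rewrite expR_ge0.
rewrite {1}DE ge0_integral_bigcup; last 4 first.
- by move=> c; apply: measurableI.
- apply: measurable_funTS.
  exact: (mfun_nat (fun k => s ^+ k) (measurable_sumn q j l.+1)).
- by move=> w _; rewrite lee_fin exprn_ge0.
- by move=> a b _ _ [w [[_ /= wa] [_ /= wb]]]; rewrite -wa -wb.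
transitivity (\sum_(0 <= c <oo) ((fine (P D) * poisson_pgf m s ^+ l)%:E * (poisson_pmf m c * s ^+ c)%:E))%E.
  apply: eq_eseriesr => c _.
  have [PF iF] := indep_of_setI [set c] hD Ij.
  transitivity (\int[P]_(w in F c) ((s ^+ c)%:E * (s ^+ (\sum_(i < l) xi (q, (j.+1 + i)%N) w)%N)%:E))%E.
    apply: eq_integral => w; rewrite inE => -[_ /= wc].
    rewrite big_ord_recl /= addn0 wc exprD EFinM; congr (_ * (s ^+ _)%:E)%E.
    by apply: eq_bigr => i _; rewrite addSnnS.
  rewrite ge0_integralZl_EFin //; last 4 first.
  - exact: measurableI.
  - by move=> w _; rewrite lee_fin exprn_ge0.
  - apply: measurable_funTS.
    exact: (mfun_nat (fun k => s ^+ k) (measurable_sumn q j.+1 l)).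
  - by rewrite exprn_ge0.
  rewrite IH; last first.
    apply: indep_of_sub iF => -[x y]; rewrite !inE /= xpair_eqE; lia.
  rewrite PF; case: iid => _ ->; rewrite -[P D]fineK ?fin_num_measure //.
  by rewrite -!EFinM fineK ?fin_num_measure //; congr EFin; ring.
rewrite nneseriesZl; last first.
  by move=> c _; rewrite lee_fin mulr_ge0 ?poisson_pmf_ge0 ?exprn_ge0.
rewrite poisson_series // exprS -[P D in RHS]fineK ?fin_num_measure //.
by rewrite -!EFinM; congr EFin; ring.
Qed.

Lemma integral_bgw (s : R) q : 0 <= s <= 1 ->
  (\int[P]_w (s ^+ bgw xi q w)%:E = (progeny_pgf m 1 s q)%:E)%E.
Proof.
elim: q s => [|q IH] s s01.
  by rewrite /= integral_cst // [X in (_ * X)%E]probability_setT mule1.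
have /andP[s0 s1] := s01.
have f01 : 0 <= poisson_pgf m s <= 1.
  by have := poisson_pgf01; rewrite expR_ge0 /= expR_le1 oppr_le0 mulr_ge0 ?(ltW m0) ?subr_ge0.
pose F l := [set w | bgw xi q w = l].
have TE : setT = \bigcup_l F l by apply/seteqP; split=> w // _; exists (bgw xi q w).
have mF l : measurable (F l) by case: (bgw_indep q l).
have tF : trivIset setT F by move=> a b _ _ [w [/= <- <-]].
have hsplit (h : nat -> R) r : (forall k, 0 <= h k) ->
    (\int[P]_w (h (bgw xi r w))%:E = \sum_(0 <= l <oo) \int[P]_(w in F l) (h (bgw xi r w))%:E)%E.
  move=> h0; rewrite [in LHS]TE ge0_integral_bigcup //.
    by apply: measurable_funTS; apply: mfun_nat; exact: measurable_bgw.
  by move=> w _; rewrite lee_fin.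
rewrite (hsplit (fun k => s ^+ k) q.+1); last by move=> k; rewrite exprn_ge0.
transitivity (\sum_(0 <= l <oo) \int[P]_(w in F l) (poisson_pgf m s ^+ bgw xi q w)%:E)%E.
  apply: eq_eseriesr => l _.
  transitivity (\int[P]_(w in F l) (s ^+ (\sum_(i < l) xi (q, (0 + i)%N) w)%N)%:E)%E.
    by apply: eq_integral => w; rewrite inE /= => ->.
  rewrite integral_sibs //; last first.
    by apply: indep_of_sub (bgw_indep q l) => x; rewrite !inE => /andP[/eqP ->].
  transitivity (\int[P]_(w in F l) (poisson_pgf m s ^+ l)%:E)%E.
    by rewrite integral_cst // muleC.
  by apply: eq_integral => w; rewrite inE /= => ->.
rewrite -(hsplit (fun k => poisson_pgf m s ^+ k) q); last first.
  by move=> k; rewrite exprn_ge0 // expR_ge0.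
by rewrite IH // /progeny_pgf iterSr mul1r.
Qed.

End GaltonWatson.

Section NonnegativeVersion.
Context (R : realType) (d : measure_display) (T : measurableType d).
Variables (P : probability T R) (m : R) (xi : nat * nat -> {RV P >-> nat}).
Variable W : {RV P >-> R}.
Hypothesis m0 : 0 < m.

Lemma bgw_limit_ge0 : bgw_limit m xi W -> {ae P, forall w, 0 <= W w}.
Proof.
apply: filterS => w h; apply: (cvgr_to_ge h); apply: nearW => r.
by rewrite mulr_ge0 // invr_ge0 exprn_ge0 // ltW.
Qed.

(** The limit is nonnegative only almost everywhere; passing to [max(W, 0)], with the same law,
    removes this exception from all later pointwise bounds. *)
Lemma nonneg_version : bgw_limit m xi W ->
  exists V : {RV P >-> R}, [/\ forall w, 0 <= V w, bgw_limit m xi V &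
    forall A, measurable A -> distribution P W A = distribution P V A].
Proof.
move=> hW; have W0 := bgw_limit_ge0 hW.
have mV : measurable_fun setT (fun w => Num.max (W w) 0).
  by apply: measurable_maxr => //; exact: measurable_funP.
pose V : {RV P >-> R} := mfun_Sub (mem_set mV).
have VE w : V w = Num.max (W w) 0 by [].
have WV : {ae P, forall w, W w = V w}.
  by apply: filterS W0 => w w0; rewrite VE (max_idPl w0).
exists V; split=> [w||A mA].
- by rewrite VE le_max lexx orbT.
- by apply: filterS2 hW WV => w + <-.
rewrite /distribution /= /pushforward.
have mWA : measurable (W @^-1` A) by exact: measurable_funPTI.
have mVA : measurable (V @^-1` A) by exact: measurable_funPTI.
have H B : measurable B -> P B = (\int[P]_w (\1_B w)%:E)%E.
  by move=> mB; rewrite integral_indic // setIT.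
rewrite !H //.
apply: ae_eq_integral => //; try by apply/measurable_EFinP; exact: measurable_indic.
apply: filterS WV => w e _; rewrite !indicE; congr (_%:R%:E).
congr (nat_of_bool _); rewrite (_ : W @^-1` A = fun w => A (W w)) // (_ : V @^-1` A = fun w => A (V w)) //.
by apply/idP/idP => /set_mem h; apply/mem_set; move: h; rewrite e.
Qed.

End NonnegativeVersion.

(** * Laplace transform and second moment of the limit *)

Section LimitLaw.
Context (R : realType) (d : measure_display) (T : measurableType d).
Variables (P : probability T R) (m : R) (xi : nat * nat -> {RV P >-> nat}).
Variable V : {RV P >-> R}.
Hypotheses (m1 : 1 < m) (iid : poisson_iid m xi) (hV : bgw_limit m xi V).
Hypothesis V0 : forall w, 0 <= V w.
Let kap := m / (m - 1).

Let m0 : 0 < m. Proof. exact: lt_trans m1. Qed.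

Definition laplace (th : R) : R := fine (\int[P]_w (expR (- (th * V w)))%:E)%E.

Lemma measurable_laplace_integrand th :
  measurable_fun setT (fun w => expR (- (th * V w))).
Proof.
apply: measurableT_comp; first exact: measurable_expR.
apply: measurableT_comp; first exact: oppr_measurable.
by apply: measurable_funM => //; exact: measurable_funP.
Qed.

Let mexp th : measurable_fun setT ((fun w => (expR (- (th * V w)))%:E) : T -> \bar R).
Proof. by apply/measurable_EFinP; exact: measurable_laplace_integrand. Qed.

Lemma integral_laplace th : 0 <= th ->
  (\int[P]_w (expR (- (th * V w)))%:E = (laplace th)%:E)%E.
Proof.
move=> th0; rewrite /laplace fineK // ge0_fin_numE; last first.
  by apply: integral_ge0 => w _; rewrite lee_fin expR_ge0.
apply: (@le_lt_trans _ _ (\int[P]_w 1)%E); last first.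
  by rewrite integral_cst // mul1e [X in (X < _)%E]probability_setT ltry.
apply: ge0_le_integral => // w _.
by rewrite lee_fin expR_le1 oppr_le0 mulr_ge0.
Qed.

(** Supplies the hypothesis [phi_lim] for [phi = laplace V]: dominated convergence with bound 1, the
    integrals being computed by [integral_bgw]. *)
Lemma laplace_lim th : 0 <= th ->
  (fun b => progeny_pgf m 1 (expR (- (th * m ^- b))) b) @ \oo --> laplace th.
Proof.
move=> th0.
pose f (r : nat) (w : T) : \bar R := (expR (- (th * m ^- r)) ^+ bgw xi r w)%:E.
have mV r : 0 <= th * m ^- r by rewrite mulr_ge0 // invr_ge0 exprn_ge0 // ltW.
have s01 r : 0 <= expR (- (th * m ^- r)) <= 1 by rewrite expR_ge0 expR_le1 oppr_le0 mV.
have mf r : measurable_fun setT (f r).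
  apply/measurable_EFinP.
  apply: (@measurableT_comp _ _ _ _ _ _ (fun k => expR (- (th * m ^- r)) ^+ k)).
    by move=> _ Y _; exact: Logic.I.
  exact: (measurable_bgw m0 iid r).
have [] := @dominated_convergence _ _ _ P setT measurableT f
  (fun w => (expR (- (th * V w)))%:E) (cst 1%E) mf (mexp th).
- apply: filterS hV => w h _; apply: cvg_EFin; first exact: nearW.
  rewrite (_ : _ \o _ = fun r => expR (- (th * (m ^- r * (bgw xi r w)%:R)))).
    apply: (@continuous_cvg _ _ _ _ _ _ (fun x => expR (- (th * x)))); last exact: h.
    apply: (@continuous_comp _ _ _ (fun x : R => - (th * x)) expR); last exact: continuous_expR.
    by apply: cvgN; apply: cvgM; [exact: cvg_cst|exact: cvg_id].
  by apply/funext => r /=; rewrite -expRM_natr; congr expR; ring.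
- apply/integrableP; split; first exact: measurable_cst.
  under eq_integral do rewrite /= normr1.
  by rewrite integral_cst // mul1e [X in (X < _)%E]probability_setT ltry.
- apply: nearW => w r _; rewrite /f /= lee_fin; case/andP: (s01 r) => a b.
  by rewrite ger0_norm ?exprn_ge0 // exprn_ile1.
move=> _ _; rewrite (integral_laplace th0) => h.
rewrite (_ : (fun b => _) = fine \o (fun r => \int[P]_w f r w)%E).
  exact: fine_cvg h.
by apply/funext => r /=; rewrite (integral_bgw m0 iid r (s01 r)).
Qed.

(* Fatou's lemma for [((1 - exp (- t V)) / t) ^ 2] as [t] tends to 0: its expectation
   is [(1 - 2 phi t + phi (2 t)) / t ^ 2]. *)
Lemma second_moment : (\int[P]_w (V w ^+ 2)%:E <= (4 * kap)%:E)%E.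
Proof.
pose th (i : nat) : R := i.+1%:R^-1.
have th0 i : 0 < th i by rewrite invr_gt0.
pose f i (w : T) : \bar R := (((1 - expR (- (th i * V w))) / th i) ^+ 2)%:E.
have mf i : measurable_fun setT (f i).
  apply/measurable_EFinP; apply: measurable_funX; apply: measurable_funM => //.
  by apply: measurable_funB => //; exact: measurable_laplace_integrand.
have f0 i w : (0 <= f i w)%E by rewrite lee_fin sqr_ge0.
have lim w : f ^~ w @ \oo --> (V w ^+ 2)%:E.
  apply: cvg_EFin; first exact: nearW.
  rewrite (_ : _ \o _ = fun i => ((1 - expR (- (th i * V w))) / th i) ^+ 2) //.
  have h : (fun i => (1 - expR (- (th i * V w))) / th i) @ \oo --> V w.
    apply: (@squeeze_cvgr _ _ _ _ (fun i => V w - th i * V w ^+ 2) (cst (V w))).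
    - apply: nearW => i /=; have x0 : 0 <= th i * V w by rewrite mulr_ge0 // ltW.
      have h1 := expRN_ge (th i * V w); have h2 := expRN_le x0.
      have e1 : (1 - expR (- (th i * V w))) / th i * th i = 1 - expR (- (th i * V w)).
        by rewrite divfK // gt_eqF.
      rewrite exprMn in h2.
      apply/andP; split; rewrite -(ler_pM2r (th0 i)) e1; last by lra.
      rewrite (_ : _ * th i = th i * V w - th i ^+ 2 * V w ^+ 2); last by ring.
      lra.
    - rewrite -[X in _ --> X]subr0 -[X in _ - X](mul0r (V w ^+ 2)).
      apply: cvgB; first exact: cvg_cst.
      by apply: cvgM; [exact: cvg_harmonic|exact: cvg_cst].
    - exact: cvg_cst.
  rewrite expr2; under eq_fun do rewrite expr2.
  exact: cvgM.
have E i : (\int[P]_w f i w <= (4 * kap)%:E)%E.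
  pose c : R := (th i ^+ 2)^-1.
  have c0 : 0 <= c by rewrite invr_ge0 sqr_ge0.
  pose g w : \bar R := ((1 - expR (- (th i * V w))) ^+ 2)%:E.
  have g0 w : (0 <= g w)%E by rewrite lee_fin sqr_ge0.
  have mg : measurable_fun setT g.
    apply/measurable_EFinP; apply: measurable_funX.
    by apply: measurable_funB => //; exact: measurable_laplace_integrand.
  have -> : (\int[P]_w f i w = c%:E * \int[P]_w g w)%E.
    rewrite -ge0_integralZl_EFin //; apply: eq_integral => w _.
    by rewrite /f /g /c -EFinM expr_div_n mulrC.
  have e : (\int[P]_w g w + 2%:E * \int[P]_w (expR (- (th i * V w)))%:E =
      1 + \int[P]_w (expR (- (2 * th i * V w)))%:E)%E.
    rewrite -ge0_integralZl_EFin //.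
    rewrite -ge0_integralD //; last exact: measurable_funeM.
    transitivity (\int[P]_w (1 + (expR (- (2 * th i * V w)))%:E))%E.
      apply: eq_integral => w _; rewrite /g -EFinM -!EFinD; congr EFin.
      rewrite (_ : - (2 * th i * V w) = - (th i * V w) + - (th i * V w)); last by ring.
      by rewrite expRD; ring.
    rewrite ge0_integralD //.
    by rewrite integral_cst // mul1e [X in (X + _)%E]probability_setT.
  have lim' := laplace_lim.
  have t1 := ltW (th0 i); have t2 : 0 <= 2 * th i by rewrite mulr_ge0.
  rewrite !integral_laplace // -EFinM -EFinD in e.
  (* In 1 - 2 phi t + phi (2 t) the constant and linear terms cancel, leaving at most 4 kap t^2. *)
  have p1 := phi_ge m1 lim' t1; have p2 := phi_le m1 lim' t2.
  have gE : (\int[P]_w g w = (1 + laplace (2 * th i) - 2 * laplace (th i))%:E)%E.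
    rewrite EFinB -e addeK //.
  rewrite gE -EFinM lee_fin /c mulrC ler_pdivrMr ?exprn_gt0 //.
  rewrite -/kap in p2; rewrite exprMn in p2; lra.
have := @fatou _ _ _ P setT measurableT f mf (fun i w _ => f0 i w).
rewrite (_ : (fun w => limn_einf (f ^~ w)) = fun w => (V w ^+ 2)%:E); last first.
  by apply/funext => w; have [-> _] := cvg_limn_einf_sup (lim w).
move/le_trans; apply; rewrite limn_einf_lim; apply: lime_le.
  exact: is_cvg_einfs.
apply: nearW => i; apply: le_trans (E i); rewrite /einfs /=.
by apply: ereal_inf_lbound; exists i => /=.
Qed.

End LimitLaw.

(** * Integration against the law of the limit *)

Section ProductLaw.
Context (R : realType) (d : measure_display) (T : measurableType d).
Variables (P : probability T R) (V : {RV P >-> R}).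
Hypothesis V0 : forall w, 0 <= V w.
Implicit Types c : R.

Let g c (z : R * R) : \bar R := (expR (- (c * z.1 * z.2)))%:E.

Let mg c : measurable_fun setT (g c).
Proof.
apply/measurable_EFinP; apply: measurableT_comp; first exact: measurable_expR.
apply: measurableT_comp; first exact: oppr_measurable.
apply: measurable_funM; last exact: measurable_snd.
by apply: measurable_funM => //; exact: measurable_fst.
Qed.

Let g0 c z : (0 <= g c z)%E. Proof. by rewrite lee_fin expR_ge0. Qed.

Let fubini_laplace c : 0 <= c ->
  (fun w => fubini_F (distribution P V) (g c) (V w)) =
  (fun w => (laplace V (c * V w))%:E).
Proof.
move=> c0; apply/funext => w; rewrite /fubini_F ge0_integral_distribution //.
- by rewrite -integral_laplace // mulr_ge0.
- by apply: measurableT_comp; first exact: mg; exact: pair1_measurable.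
Qed.

Lemma measurable_laplace c : 0 <= c ->
  measurable_fun setT (fun w => laplace V (c * V w)).
Proof.
move=> c0; apply/measurable_EFinP.
rewrite (_ : _ \o _ = fun w => (laplace V (c * V w))%:E) // -fubini_laplace //.
apply: (@measurableT_comp _ _ _ _ _ _ (fubini_F (distribution P V) (g c))).
  exact: measurable_fun_fubini_tonelli_F.
exact: measurable_funP.
Qed.

(** The joint law of an independent pair is the product law, checked on rectangles; Tonelli then
    integrates out one factor. The pair may live on another space than [V], since only laws
    matter. *)
Lemma expectation_product_laplace (d' : measure_display) (T' : measurableType d')
    (P' : probability T' R) (W W' : {RV P' >-> R}) c : 0 <= c ->
  (forall A, measurable A -> distribution P' W A = distribution P V A) ->
  (forall A, measurable A -> distribution P' W' A = distribution P V A) ->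
  independent_pair W W' ->
  ('E_P'[fun w => expR (- (c * W w * W' w))] =
   \int[P]_w (laplace V (c * V w))%:E)%E.
Proof.
move=> c0 lW lW' ind; rewrite unlock.
have mX : measurable_fun setT (fun w => (W w, W' w)).
  by apply: measurable_fun_pair; exact: measurable_funP.
pose X : {RV P' >-> (R * R)%type} := mfun_Sub (mem_set mX).
transitivity (\int[distribution P' X]_z g c z)%E.
  by rewrite ge0_integral_distribution.
rewrite (eq_measure_integral (distribution P V \x distribution P V)%E); last first.
  move=> A mA _; apply/esym; apply: product_measure_unique => // B C mB mC.
  transitivity (P' (W @^-1` B) * P' (W' @^-1` C))%E; first exact: ind.
  by congr (_ * _)%E; [exact: lW|exact: lW'].
rewrite fubini_tonelli1 // ge0_integral_distribution.
- by rewrite -(fubini_laplace c0).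
- exact: measurable_fun_fubini_tonelli_F.
- by move=> y; apply: integral_ge0.
Qed.

Lemma integral_mixture (r : seq (R * R)) :
  (forall x, x \in r -> 0 <= x.1 /\ 0 <= x.2) ->
  measurable_fun setT (fun w => \sum_(x <- r) x.1 * expR (- (x.2 * V w))) /\
  (\int[P]_w (\sum_(x <- r) x.1 * expR (- (x.2 * V w)))%:E =
    (\sum_(x <- r) x.1 * laplace V x.2)%:E)%E.
Proof.
elim: r => [|x r IH] h.
  split; first by under eq_fun do rewrite big_nil; exact: measurable_cst.
  by under eq_integral do rewrite big_nil; rewrite integral0 big_nil.
have [|mr ir] := IH; first by move=> y yr; apply: h; rewrite inE yr orbT.
have [x0 x1] : 0 <= x.1 /\ 0 <= x.2 by apply: h; rewrite mem_head.
have mx : measurable_fun setT (fun w => x.1 * expR (- (x.2 * V w))).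
  by apply: measurable_funM => //; exact: measurable_laplace_integrand.
split; first by under eq_fun do rewrite big_cons; exact: measurable_funD.
under eq_integral do rewrite big_cons EFinD.
rewrite ge0_integralD //.
- rewrite ir big_cons EFinD; congr (_ + _)%E; rewrite EFinM -integral_laplace //.
  rewrite -ge0_integralZl_EFin //.
  by apply/measurable_EFinP; exact: measurable_laplace_integrand.
- by move=> w _; rewrite lee_fin mulr_ge0 // expR_ge0.
- exact/measurable_EFinP.
- move=> w _; rewrite lee_fin big_seq; apply: sumr_ge0 => y yr.
  have [y0 _] : 0 <= y.1 /\ 0 <= y.2 by apply: h; rewrite inE yr orbT.
  by rewrite mulr_ge0 // expR_ge0.
- exact/measurable_EFinP.
Qed.

(** From V <= 1 + V^2, only the second moment is needed. By symmetry it suffices to bound a from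
    above, which keeps all integrands nonnegative. *)
Lemma integral_dist_le (f h : T -> R) (a b A B K : R) :
  (\int[P]_w (V w ^+ 2)%:E <= K%:E)%E ->
  measurable_fun setT f -> measurable_fun setT h ->
  (forall w, 0 <= f w) -> (forall w, 0 <= h w) -> 0 <= A -> 0 <= B ->
  (forall w, `|f w - h w| <= A * V w + B * V w ^+ 2) ->
  (\int[P]_w (f w)%:E = a%:E)%E -> (\int[P]_w (h w)%:E = b%:E)%E ->
  `|a - b| <= A + (A + B) * K.
Proof.
move=> hK; wlog suff : f h a b / (measurable_fun setT f -> measurable_fun setT h ->
  (forall w, 0 <= f w) -> (forall w, 0 <= h w) -> 0 <= A -> 0 <= B ->
  (forall w, `|f w - h w| <= A * V w + B * V w ^+ 2) ->
  (\int[P]_w (f w)%:E = a%:E)%E -> (\int[P]_w (h w)%:E = b%:E)%E ->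
  a <= b + (A + (A + B) * K)).
  move=> S mf mh f0 h0 A0 B0 fh fa hb.
  have h1 := S f h a b mf mh f0 h0 A0 B0 fh fa hb.
  have fh' w : `|h w - f w| <= A * V w + B * V w ^+ 2 by rewrite distrC.
  have h2 := S h f b a mh mf h0 f0 A0 B0 fh' hb fa.
  by rewrite ler_norml; apply/andP; split; lra.
move=> mf mh f0 h0 A0 B0 fh fa hb.
rewrite -lee_fin -fa.
have mV2 : measurable_fun setT (fun w => (V w ^+ 2)%:E : \bar R).
  by apply/measurable_EFinP; apply: measurable_funX; exact: measurable_funP.
have AB0 : 0 <= A + B by rewrite addr_ge0.
have V20 w : (0 <= (V w ^+ 2)%:E :> \bar R)%E by rewrite lee_fin sqr_ge0.
have mABV : measurable_fun setT (fun w => (A + B)%:E * (V w ^+ 2)%:E : \bar R)%E.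
  exact: measurable_funeM.
have ABV0 w : (0 <= (A + B)%:E * (V w ^+ 2)%:E :> \bar R)%E by rewrite mule_ge0.
have mA : measurable_fun setT (fun w : T => A%:E + (A + B)%:E * (V w ^+ 2)%:E : \bar R)%E.
  exact: emeasurable_funD.
have A0' w : (0 <= A%:E + (A + B)%:E * (V w ^+ 2)%:E :> \bar R)%E by rewrite adde_ge0.
apply: (@le_trans _ _ (\int[P]_w ((h w)%:E + (A%:E + (A + B)%:E * (V w ^+ 2)%:E)))%E).
  apply: ge0_le_integral => //.
  - by move=> w _; rewrite lee_fin.
  - exact/measurable_EFinP.
  - by apply: emeasurable_funD => //; exact/measurable_EFinP.
  - move=> w _; rewrite -EFinM -!EFinD lee_fin.
    have := fh w; rewrite ler_norml => /andP[_ h1].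
    have v2 : V w <= 1 + V w ^+ 2 by have := sqr_ge0 (V w - 1); have := V0 w; nra.
    have := ler_wpM2l A0 v2; lra.
rewrite ge0_integralD //; last 2 first.
- by move=> w _; rewrite lee_fin.
- exact/measurable_EFinP.
rewrite hb [leRHS]EFinD; apply: leeD2l.
rewrite ge0_integralD // integral_cst // [X in (_ * X + _)%E]probability_setT mule1.
rewrite [leRHS]EFinD; apply: leeD2l; rewrite ge0_integralZl_EFin // [leRHS]EFinM.
by apply: lee_wpmul2l.
Qed.

End ProductLaw.

(** * Conclusion *)

Section MainBound.
Context (R : realType) (d : measure_display) (T : measurableType d).
Variables (P : probability T R) (m : R) (xi : nat * nat -> {RV P >-> nat}).
Variable V : {RV P >-> R}.
Hypotheses (m1 : 1 < m) (iid : poisson_iid m xi) (hV : bgw_limit m xi V).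
Hypothesis V0 : forall w, 0 <= V w.
Variables (n b j : nat).
Hypotheses (mn2 : 2 * m <= n%:R) (jb : (j <= b.+1)%N).
Let kap := m / (m - 1).
Let M := m ^+ b.
Let Mj := m ^+ j.
Let lam := - ln (1 - m / n%:R).
Let c := m / n%:R * Mj * kap * M.
Let err : R := M / n%:R + b.+1%:R * M ^+ 3 / n%:R ^+ 2.

Let m0 : 0 < m. Proof. exact: lt_trans m1. Qed.
Let n0 : (0 : R) < n%:R. Proof. by apply: lt_le_trans mn2; rewrite mulr_gt0. Qed.
Let kap1 : 1 <= kap.
Proof. by rewrite /kap ler_pdivlMr ?subr_gt0 // mul1r gerBl. Qed.
Let k0 : 0 <= kap. Proof. by apply: le_trans kap1. Qed.
Let M1 : 1 <= M. Proof. by rewrite /M exprn_ege1 // ltW. Qed.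
Let M0 : 0 <= M. Proof. exact: le_trans M1. Qed.
Let Mj0 : 0 <= Mj. Proof. by rewrite exprn_ge0 // ltW. Qed.
Let MjM : Mj <= m * M. Proof. by rewrite /M -exprS; apply: ler_weXn2l => //; exact: ltW. Qed.

Let c0 : 0 <= c.
Proof. by rewrite /c ?(k0, M0, Mj0, divr_ge0, ltW m0, ltW n0, mulr_ge0). Qed.

Let q01 : 0 <= 1 - m / n%:R <= 1.
Proof.
have : m / n%:R <= 1 by rewrite ler_pdivrMr // mul1r; move: mn2 m0; lra.
have : 0 < m / n%:R by rewrite divr_gt0.
by move=> *; apply/andP; split; lra.
Qed.

Let lam0 : 0 <= lam.
Proof. by rewrite /lam oppr_ge0; apply: ln_le0; case/andP: q01. Qed.

Local Notation E k g S0 := (iter k (rf_step (1 - m / n%:R)) g 0%N S0 1%N).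

Let Psi w := E b (fun a _ J => expR (- (Mj * (lam * (a + J)%N%:R) * w))) n.
Let psi := E b (fun a _ J => laplace V (Mj * (lam * (a + J)%N%:R))) n.

(** By [rf_repr], [Psi] is a finite positive combination of exponentials, so integrating over [V]
    turns each exponential into [laplace V]. *)
Let Psi_int : [/\ measurable_fun setT (fun w => Psi (V w)), forall w, 0 <= Psi (V w) &
  (\int[P]_w (Psi (V w))%:E = psi%:E)%E].
Proof.
have [r [rP rE]] := rf_repr q01 b 0 n 1.
pose r' := [seq (x.1, Mj * (lam * (x.2.1.1 + x.2.2)%N%:R)) | x <- r].
have r'P x : x \in r' -> 0 <= x.1 /\ 0 <= x.2.
  case/mapP => y yr -> /=; have [y0 _ _] := rP y yr; split=> //.
  by rewrite ?(Mj0, lam0, ler0n, mulr_ge0).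
have [mr ir] := integral_mixture V0 r'P.
have PE w : Psi (V w) = \sum_(x <- r') x.1 * expR (- (x.2 * V w)).
  by rewrite /Psi rE /r' big_map.
have pE : psi = \sum_(x <- r') x.1 * laplace V x.2 by rewrite /psi rE /r' big_map.
split.
- by under eq_fun do rewrite PE.
- move=> w; rewrite PE big_seq; apply: sumr_ge0 => x /r'P[x0 _].
  by rewrite mulr_ge0 // expR_ge0.
- by under eq_integral do rewrite PE; rewrite ir pE.
Qed.

Let coef (i l : nat) (X : R) : (i <= 5)%N -> (l <= 4)%N -> 0 <= X ->
  kap ^+ i * m ^+ l * X <= kap ^+ 5 * m ^+ 4 * X.
Proof.
move=> i5 l4 X0; apply: ler_wpM2r => //; apply: ler_pM.
- exact: exprn_ge0.
- by apply: exprn_ge0; exact: ltW.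
- exact: ler_weXn2l.
- by apply: ler_weXn2l => //; exact: ltW.
Qed.

Let v : R := M ^+ 3 / n%:R ^+ 2.
Let v0 : 0 <= v.
Proof.
by apply: divr_ge0; apply: exprn_ge0; [exact: M0|exact: ltW].
Qed.
Let u0 : 0 <= M / n%:R. Proof. by apply: divr_ge0; [exact: M0|exact: ltW]. Qed.
Let n20 : 0 <= (n%:R ^+ 2 : R)^-1. Proof. by rewrite invr_ge0 sqr_ge0. Qed.

Let mon1 : Mj / n%:R <= m * (M / n%:R).
Proof. by rewrite mulrA; apply: ler_wpM2r; rewrite ?invr_ge0 ?(ltW n0). Qed.

Let mon2 : M ^+ 2 * Mj / n%:R ^+ 2 <= m * v.
Proof.
rewrite /v mulrA; apply: ler_wpM2r => //.
by have := ler_wpM2l (sqr_ge0 M) MjM; rewrite (_ : M ^+ 2 * (m * M) = m * M ^+ 3) //; ring.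
Qed.

Let mon3 : M * Mj ^+ 2 / n%:R ^+ 2 <= m ^+ 2 * v.
Proof.
rewrite /v mulrA; apply: ler_wpM2r => //.
have h : Mj ^+ 2 <= (m * M) ^+ 2.
  by rewrite lerXn2r // nnegrE // (le_trans Mj0).
have := ler_wpM2l M0 h; rewrite (_ : M * (m * M) ^+ 2 = m ^+ 2 * M ^+ 3) //; ring.
Qed.

Let mon4 : M * Mj / n%:R ^+ 2 <= m * v.
Proof.
apply: le_trans mon2; apply: ler_wpM2r => //; apply: ler_wpM2r => //.
by rewrite expr2 ler_peMr.
Qed.

(** Chains [two_sided], [one_side_phi] and the integrated [mixture_phi]. As j is at most b + 1,
    every [m ^+ j] is at most m M, so all terms reduce to M / n and M^3 / n^2; 120 is a rounded sum
    of their coefficients. *)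
Lemma gnp_prob_laplace : exists e : R,
  [/\ (\int[P]_w (laplace V (c * V w))%:E = e%:E)%E, 0 <= e <= 1 &
  `|gnp_prob (m / n%:R) (fun E (v v' : 'I_n) => ((j + b.+1)%N%:R%:E < gdist R E v v')%E) - e|
    <= 120 * kap ^+ 5 * m ^+ 4 * err].
Proof.
have plim := laplace_lim m1 iid hV V0.
have lap01 w : 0 <= laplace V (c * V w) <= 1.
  by apply: (phi01 m1 plim); rewrite mulr_ge0.
have ml := measurable_laplace V0 c0.
pose e := fine (\int[P]_w (laplace V (c * V w))%:E)%E.
have ile : (0 <= \int[P]_w (laplace V (c * V w))%:E <= 1)%E.
  apply/andP; split.
    by apply: integral_ge0 => w _; rewrite lee_fin; case/andP: (lap01 w).
  apply: (@le_trans _ _ (\int[P]_w 1)%E); last first.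
    by rewrite integral_cst // mul1e [X in (X <= _)%E]probability_setT.
  apply: ge0_le_integral => //.
  - by move=> w _; rewrite lee_fin; case/andP: (lap01 w).
  - exact/measurable_EFinP.
  - by move=> w _; rewrite lee_fin; case/andP: (lap01 w).
case/andP: ile => i0 i1.
have eE : (\int[P]_w (laplace V (c * V w))%:E = e%:E)%E.
  by rewrite /e fineK // ge0_fin_numE // (le_lt_trans i1) // ltry.
exists e; split => //.
  by rewrite -!lee_fin -eE i0 i1.
have n1 : (0 < n)%N by rewrite -(ltr_nat R).
rewrite gnp_prob_gdist //.
have s1 := two_sided m1 mn2 b j.
have s2 := one_side_phi m1 mn2 b j plim.
have [mP P0 iP] := Psi_int.
rewrite -/kap -/M -/Mj in s1 s2.
set A := 8 * kap ^+ 4 * m * M ^+ 2 * Mj / n%:R ^+ 2 + 2 * kap * m * Mj / n%:R +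
    2 * kap * m ^+ 2 * M * Mj / n%:R ^+ 2.
set B := 8 * kap ^+ 3 * m ^+ 2 * b.+1%:R * M * Mj ^+ 2 / n%:R ^+ 2.
have s3 w : `|Psi (V w) - laplace V (c * V w)| <= A * V w + B * V w ^+ 2.
  exact: (mixture_phi m1 mn2 b j plim (V0 w)).
have nn := ltW n0.
have K5 := exprn_ge0 5 k0; have K4 := exprn_ge0 4 k0; have K3 := exprn_ge0 3 k0.
have mm := ltW m0.
have A0 : 0 <= A.
  rewrite /A; do 2?[apply: addr_ge0]; apply: divr_ge0; rewrite ?sqr_ge0 //.
  - by rewrite ?(K4, mm, M0, Mj0, sqr_ge0, mulr_ge0).
  - by rewrite ?(k0, mm, M0, Mj0, sqr_ge0, mulr_ge0).
  - by rewrite ?(k0, mm, M0, Mj0, sqr_ge0, mulr_ge0).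
have B0 : 0 <= B.
  rewrite /B; apply: divr_ge0; rewrite ?sqr_ge0 //.
  by rewrite ?(K3, mm, M0, Mj0, ler0n, sqr_ge0, mulr_ge0).
have L0 w : 0 <= laplace V (c * V w) by case/andP: (lap01 w).
have s4 := integral_dist_le V0 (second_moment m1 iid hV V0) mP ml P0 L0 A0 B0 s3 iP eE.
set x1 := n%:R^-1 * _ in s1 *; set x2 := iter j _ _ _ _ _ in s1 s2.
have h : `|x1 - e| <= _ := le_trans (ler_distD x2 _ _) (lerD s1 (le_trans (ler_distD psi _ _) (lerD s2 s4))).
apply: le_trans h _.
pose C := kap ^+ 5 * m ^+ 4.
have C0 : 0 <= C by rewrite /C mulr_ge0 // exprn_ge0.
have bv0 : 0 <= b%:R * v by rewrite mulr_ge0.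
have bv1 : 0 <= b.+1%:R * v by rewrite mulr_ge0.
have t1 : kap * Mj / n%:R <= C * (M / n%:R).
  have := coef (i := 1) (l := 1) isT isT u0; rewrite !expr1.
  by have := ler_wpM2l k0 mon1; rewrite -/C; lra.
have t2 : kap ^+ 4 * m * (M ^+ 2 * Mj / n%:R ^+ 2) <= kap ^+ 4 * m * (m * v).
  by apply: ler_wpM2l; rewrite ?(K4, mm, mulr_ge0).
have t2' := coef (i := 4) (l := 2) isT isT v0; rewrite -/C in t2'.
have t3 : kap ^+ 3 * m * b%:R * (M * Mj ^+ 2 / n%:R ^+ 2) <= kap ^+ 3 * m * b%:R * (m ^+ 2 * v).
  by apply: ler_wpM2l; rewrite ?(K3, mm, ler0n, mulr_ge0).
have t3' := coef (i := 3) (l := 3) isT isT bv0; rewrite -/C in t3'.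
have t4 : kap ^+ 5 * m * (M * Mj ^+ 2 / n%:R ^+ 2) <= kap ^+ 5 * m * (m ^+ 2 * v).
  by apply: ler_wpM2l; rewrite ?(K5, mm, mulr_ge0).
have t4' := coef (i := 5) (l := 3) isT isT v0; rewrite -/C in t4'.
have t5 : kap ^+ 4 * m ^+ 2 * (M ^+ 2 * Mj / n%:R ^+ 2) <= kap ^+ 4 * m ^+ 2 * (m * v).
  by apply: ler_wpM2l; rewrite ?(K4, mm, sqr_ge0, mulr_ge0).
have t5' := coef (i := 4) (l := 3) isT isT v0; rewrite -/C in t5'.
(* One power of [kap] is kept in reserve for the second moment [4 * kap]. *)
pose D := kap ^+ 4 * m ^+ 4.
have D0 : 0 <= D by rewrite /D mulr_ge0 // exprn_ge0.
have DC : kap * D = C by rewrite /D /C; ring.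
have DC' : D <= C by rewrite -DC ler_peMl.
have coefD (i l : nat) (X : R) : (i <= 4)%N -> (l <= 4)%N -> 0 <= X ->
    kap ^+ i * m ^+ l * X <= D * X.
  move=> i4 l4 X0; apply: ler_wpM2r => //; apply: ler_pM.
  - exact: exprn_ge0.
  - exact: exprn_ge0.
  - exact: ler_weXn2l.
  - by apply: ler_weXn2l => //; exact: ltW.
have errE : err = M / n%:R + b%:R * v + v.
  by rewrite /err /v -natr1; ring.
have Ale : A <= 10 * D * err.
  have a1 := coefD 4%N 2%N v isT isT v0; have a2 := coefD 1%N 2%N _ isT isT u0.
  have a3 := coefD 1%N 3%N v isT isT v0.
  have a4 : kap * m * (Mj / n%:R) <= kap * m * (m * (M / n%:R)).
    by apply: ler_wpM2l; rewrite ?(k0, mm, mulr_ge0).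
  have a5 : kap * m ^+ 2 * (M * Mj / n%:R ^+ 2) <= kap * m ^+ 2 * (m * v).
    by apply: ler_wpM2l; rewrite ?(k0, sqr_ge0, mulr_ge0).
  have Du := mulr_ge0 D0 u0; have Db := mulr_ge0 D0 bv0.
  rewrite errE /A; rewrite !expr1 in a2 a3; lra.
have Ble : B <= 8 * D * err.
  have b1 := coefD 3%N 4%N _ isT isT bv1.
  have b2 : kap ^+ 3 * m ^+ 2 * b.+1%:R * (M * Mj ^+ 2 / n%:R ^+ 2) <= kap ^+ 3 * m ^+ 2 * b.+1%:R * (m ^+ 2 * v).
    by apply: ler_wpM2l; rewrite ?(K3, ler0n, sqr_ge0, mulr_ge0).
  have Du := mulr_ge0 D0 u0.
  rewrite (_ : err = M / n%:R + b.+1%:R * v); last by rewrite /err /v; ring.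
  rewrite /B; lra.
have ABle : A + (A + B) * (4 * kap) <= 82 * C * err.
  have e0 : 0 <= err by rewrite errE !addr_ge0.
  have k40 : 0 <= 4 * kap by rewrite mulr_ge0.
  have := ler_wpM2r k40 (lerD Ale Ble).
  rewrite (_ : (10 * D * err + 8 * D * err) * (4 * kap) = 72 * (kap * D) * err); last by ring.
  rewrite DC; have := ler_wpM2r e0 DC'; lra.
rewrite -/kap.
have Cu := mulr_ge0 C0 u0; have Cb := mulr_ge0 C0 bv0; have Cv := mulr_ge0 C0 v0.
move: ABle; set AB := A + _; rewrite errE -(mulrA 120) -/C => ABle.
lra.
Qed.

End MainBound.

(** * Exponents, logarithms and the final constant *)

Section Final.
Variables (R : realType) (m : R).
Hypothesis m1 : 1 < m.
Let kap := m / (m - 1).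

Let m0 : 0 < m. Proof. exact: lt_trans m1. Qed.
Let mN0 : m != 0. Proof. by rewrite gt_eqF. Qed.
Let kap1 : 1 <= kap.
Proof. by rewrite /kap ler_pdivlMr ?subr_gt0 // mul1r gerBl. Qed.

(** Since 1 / kap = 1 - 1 / m, this is ln (1 / m) <= 1 / m - 1. It converts logarithms to base m
    into natural ones at the cost of a factor [kap]. *)
Lemma ln_ge_inv : 1 <= kap * ln m.
Proof.
have : ln (1 + (m^-1 - 1)) <= m^-1 - 1.
  by apply: le_ln1Dx; have : 0 < m^-1 by [rewrite invr_gt0]; lra.
rewrite addrC subrK lnV ?posrE // => h.
have k0 : 0 <= kap by apply: le_trans kap1.
have h' : 1 - m^-1 <= ln m by lra.
apply: le_trans (ler_wpM2l k0 h'); rewrite /kap le_eqVlt; apply/orP; left; apply/eqP.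
by field; rewrite mN0 subr_eq0 gt_eqF.
Qed.

Lemma expr_rn_le n : (0 < n)%N -> m ^ (2 * rn m n) <= n%:R.
Proof.
move=> n0; have nR : (0 : R) < n%:R by rewrite ltr0n.
have lm : 0 < ln m by rewrite ln_gt0.
rewrite -powR_intmul ?(ltW m0) // /powR (negbTE mN0) -[leRHS]lnK // ler_expR.
have := floor_le_tmp (2^-1 * ln n%:R / ln m : R); rewrite -/(rn m n) => h.
have := ler_wpM2r (ltW lm) h; rewrite mulfVK ?gt_eqF // intrM; lra.
Qed.

Lemma gnp_prob01 n (p : R) (k : nat) : (0 < n)%N -> 0 <= p <= 1 ->
  0 <= gnp_prob p (fun E (v v' : 'I_n) => (k%:R%:E < gdist R E v v')%E) <= 1.
Proof.
move=> n0 /andP[p0 p1]; have nR : (0 : R) < n%:R by rewrite ltr0n.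
have q01 : 0 <= 1 - p <= 1 by apply/andP; split; lra.
rewrite gnp_prob_gdist //; apply/andP; split.
  apply: mulr_ge0; first by rewrite invr_ge0 ltW.
  rewrite -[leLHS](rf_cst (1 - p) k 0 0 n.-1 1); exact: ler_rf.
rewrite mulrC ler_pdivrMr // mul1r -[leRHS](rf_cst (1 - p) k n%:R 0 n.-1 1).
by apply: ler_rf => // a S J Sn _; rewrite ler_nat (leq_trans Sn) // leq_pred.
Qed.

Lemma dist01_le1 (x y : R) : 0 <= x <= 1 -> 0 <= y <= 1 -> `|x - y| <= 1.
Proof.
move=> /andP[x0 x1] /andP[y0 y1].
by rewrite ler_norml; apply/andP; split; lra.
Qed.

(** With X = m^(u/2) n^(-1/2), so X^2 = m^u / n, the hypothesis on M gives M / n <= X and M^3 / n^2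
    <= X m^u. *)
Lemma error_le (n b : nat) (u : int) : 1 <= ln n%:R :> R -> (0 < n)%N ->
  (m ^+ b) ^+ 2 <= n%:R * m ^ u -> b.+1%:R <= 2 * kap * ln n%:R ->
  m ^+ b / n%:R + b.+1%:R * (m ^+ b) ^+ 3 / n%:R ^+ 2 <=
  3 * kap * (m `^ (u%:~R / 2) * Num.max 1 (m ^ u) * n%:R `^ (- 2^-1) * ln n%:R).
Proof.
set L := ln _; set M := m ^+ b; set U := m ^ u => L1 n0 MU bL.
have nR : (0 : R) < n%:R by rewrite ltr0n.
have U0 : 0 < U by rewrite exprz_gt0.
have M0 : 0 < M by rewrite exprn_gt0.
pose X : R := m `^ (u%:~R / 2) * n%:R `^ (- 2^-1).
have X0 : 0 < X by rewrite mulr_gt0 // powR_gt0.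
have X2 : X ^+ 2 = U / n%:R.
  rewrite /X exprMn -!powR_mulrn ?powR_ge0 // -!powRrM.
  rewrite mulfVK // powR_intmul ?(ltW m0) // mulNr mulVf // powR_inv1 ?ler0n //.
have MX : M / n%:R <= X.
  rewrite -(ler_pXn2r (n := 2)) // ?nnegrE ?(ltW X0) ?divr_ge0 ?(ltW M0) ?(ltW nR) //.
  rewrite X2 expr_div_n ler_pdivrMr ?exprn_gt0 //.
  by rewrite (_ : U / n%:R * n%:R ^+ 2 = n%:R * U) //; field; rewrite gt_eqF.
have MX3 : M ^+ 3 / n%:R ^+ 2 <= X * U.
  rewrite (_ : M ^+ 3 / n%:R ^+ 2 = M / n%:R * (M ^+ 2 / n%:R)); last by field; rewrite gt_eqF.
  apply: ler_pM => //; rewrite ?divr_ge0 ?sqr_ge0 ?(ltW M0) ?(ltW nR) //.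
  by rewrite ler_pdivrMr // mulrC.
set Y := Num.max 1 U.
have Y1 : 1 <= Y by rewrite le_max lexx.
have YU : U <= Y by rewrite le_max lexx orbT.
have k0 : 0 <= kap by apply: le_trans kap1.
rewrite (_ : 3 * kap * _ = 3 * kap * L * (X * Y)); last by rewrite /X; ring.
have XY : X <= X * Y by rewrite ler_peMr // ltW.
have XY0 : 0 <= X * Y by rewrite (le_trans (ltW X0)).
have kL : 1 <= kap * L.
  by apply: le_trans kap1 _; rewrite ler_peMr.
have e1 : M / n%:R <= kap * L * (X * Y).
  by apply: le_trans MX _; apply: le_trans XY _; rewrite ler_peMl.
have e2 : b.+1%:R * (M ^+ 3 / n%:R ^+ 2) <= 2 * kap * L * (X * Y).
  apply: ler_pM => //; first by rewrite divr_ge0 ?sqr_ge0 // exprn_ge0 // ltW.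
  by apply: le_trans MX3 _; rewrite ler_wpM2l // ltW.
rewrite -(mulrA b.+1%:R); lra.
Qed.

(** Covers the large u, for which b need not be O(log n): a difference of two numbers in [0, 1] is
    then within the claimed bound. *)
Lemma trivial_bound (n : nat) (u : int) : 1 <= ln n%:R :> R -> (0 < n)%N ->
  n%:R < m ^ u ->
  1 <= m `^ (u%:~R / 2) * Num.max 1 (m ^ u) * n%:R `^ (- 2^-1) * ln n%:R.
Proof.
set L := ln _; set U := m ^ u => L1 n0 nU.
have nR : (0 : R) < n%:R by rewrite ltr0n.
have U1 : 1 <= U by apply: le_trans (ltW nU); rewrite ler1n.
pose X : R := m `^ (u%:~R / 2) * n%:R `^ (- 2^-1).
have X0 : 0 < X by rewrite mulr_gt0 // powR_gt0.
have X2 : X ^+ 2 = U / n%:R.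
  rewrite /X exprMn -!powR_mulrn ?powR_ge0 // -!powRrM.
  rewrite mulfVK // powR_intmul ?(ltW m0) // mulNr mulVf // powR_inv1 ?ler0n //.
have X1 : 1 <= X.
  rewrite -(ler_pXn2r (n := 2)) // ?nnegrE ?(ltW X0) //.
  by rewrite X2 expr1n ler_pdivlMr // mul1r ltW.
rewrite (_ : _ * L = X * Num.max 1 U * L); last by rewrite /X; ring.
by rewrite mulr_ege1 // mulr_ege1 // le_max lexx.
Qed.

End Final.

Theorem theorem1p1 (R : realType) :
  exists C : R -> R,
    (forall delta Delta : R, 0 < delta -> 0 < Delta ->
      (ereal_sup [set (C m)%:E | m in [set m | (1 + delta <= m <= Delta)%R]]
        < +oo)%E) /\
    forall m : R, 1 < m ->
    exists N : nat, forall n : nat, (N <= n)%N ->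
    forall (d0 : measure_display) (T0 : measurableType d0)
      (P0 : probability T0 R) (xi : nat * nat -> {RV P0 >-> nat})
      (W0 : {RV P0 >-> R}),
      poisson_iid m xi -> bgw_limit m xi W0 ->
    forall (d : measure_display) (T : measurableType d) (P : probability T R)
      (W W' : {RV P >-> R}),
      (forall A : set R, measurable A ->
        distribution P W A = distribution P0 W0 A) ->
      (forall A : set R, measurable A ->
        distribution P W' A = distribution P0 W0 A) ->
      independent_pair W W' ->
    forall u : int, - (2 * rn m n) < u ->
      (`| (gnp_prob (m / n%:R) (fun E (v v' : 'I_n) =>
             ((2 * rn m n + u)%:~R%:E < gdist R E v v')%E))%:E
          - 'E_P[fun w => expR (- (m ^ (u + 1) * W w * W' w
                                   / ((m - 1) * chi m n ^+ 2)))] |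
       <= (C m * m `^ (u%:~R / 2) * Num.max 1 (m ^ u)
           * n%:R `^ (- 2^-1) * ln n%:R)%:E)%E.
Proof.
(* The product of [120 kap^5 m^4] from [gnp_prob_laplace] and [3 kap] from [error_le]. It is bounded
   on the given range because [kap <= Delta / delta] there. *)
exists (fun m => 360 * (m / (m - 1)) ^+ 6 * m ^+ 4); split=> [delta Delta d0 D0|m m1].
  apply: (@le_lt_trans _ _ (360 * (Delta / delta) ^+ 6 * Delta ^+ 4)%:E); last exact: ltry.
  apply/ereal_supP => _ [m /= /andP[dm mD] <-]; rewrite lee_fin.
  have m0 : 0 <= m by lra.
  have m10 : 0 < m - 1 by lra.
  have k0 : 0 <= m / (m - 1) by rewrite divr_ge0 // ltW.
  have kD : m / (m - 1) <= Delta / delta.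
    by apply: ler_pM; rewrite ?invr_ge0 ?(ltW m10) // lef_pV2 ?posrE //; lra.
  apply: ler_pM.
  - by apply: mulr_ge0 => //; exact: exprn_ge0.
  - exact: exprn_ge0.
  - by apply: ler_wpM2l => //; rewrite lerXn2r // nnegrE (le_trans k0).
  - by rewrite lerXn2r // nnegrE // ltW.
have m0 : 0 < m by exact: lt_trans m1.
have mN0 : m != 0 by rewrite gt_eqF.
set kap := m / (m - 1).
have kap1 : 1 <= kap by rewrite /kap ler_pdivlMr ?subr_gt0 // mul1r gerBl.
have k0 : 0 <= kap by apply: le_trans kap1.
have e0 := expR_gt0 (1 : R).
(* The summand 2 m makes [p <= 1/2], and the summand e makes [ln n >= 1]. *)
exists (Num.bound (2 * m + expR 1)) => n Nn d0 T0 P0 xi W0 iid hW0 d T P W W' lW lW' ind u ru.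
have nN : 2 * m + expR 1 <= n%:R.
  have b0 : 0 <= 2 * m + expR 1 by rewrite addr_ge0 ?mulr_ge0 ?(ltW m0) // ltW.
  by apply: le_trans (ltW (archi_boundP b0)) _; rewrite ler_nat.
have nR : 0 < n%:R :> R by lra.
have n0 : (0 < n)%N by rewrite -(ltr_nat R).
have mn2 : 2 * m <= n%:R by lra.
have L1 : 1 <= ln n%:R :> R.
  by rewrite -[leLHS]expRK ler_ln ?posrE //; lra.
have [V [V0 hV lV]] := nonneg_version m0 hW0.
(* The lower bound on u makes the threshold positive, which leaves room for the one linking step
   between the two balls. *)
have [k kE] : exists k, (2 * rn m n + u = k.+1%:Z)%R.
  have : 0 < 2 * rn m n + u by rewrite -ltrBlDl sub0r.
  by case: (2 * rn m n + u) => // -[|k] // _; exists k.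
(* Thus j is b or b + 1, and 2 b <= k. *)
pose b := k./2; pose j := (k - b)%N.
have jb : (j <= b.+1)%N by rewrite /j /b; lia.
have jbk : (j + b.+1 = k.+1)%N by rewrite /j /b; lia.
have kb : (b.*2 <= k.+1)%N by rewrite /b; lia.
have [e [eE e01 he]] := gnp_prob_laplace m1 iid hV V0 mn2 jb.
rewrite -/kap jbk in eE he.
set c := m / n%:R * m ^+ j * kap * m ^+ b in eE.
have c0 : 0 <= c by rewrite /c ?(k0, exprn_ge0, divr_ge0, ltW m0, ler0n, mulr_ge0).
have mk : m ^+ k.+1 = m ^ (2 * rn m n) * m ^ u.
  by rewrite -expfzDr // kE.
(* The exponents j and b enter [c] only through m^(j + b + 1) = m^(2 r_n + u), and the factor m^(2
   r_n) / n is 1 / chi^2. *)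
have cE : c = m ^ (u + 1) / ((m - 1) * chi m n ^+ 2).
  have c1 : c = m ^+ k.+1 * m / ((m - 1) * n%:R).
    rewrite -jbk exprD exprS /c /kap; field.
    by rewrite gt_eqF //= subr_eq0 gt_eqF.
  have chiE : chi m n ^+ 2 = (m ^ (2 * rn m n))^-1 * n%:R.
    rewrite /chi exprMn sqr_sqrtr ?ler0n //; congr (_ * _).
    have -> : 2 * rn m n = rn m n + rn m n by ring.
    by rewrite -invr_expz expr2 -invfM expfzDr.
  rewrite chiE c1 mk expfzDr // expr1z.
  have n00 : n%:R != 0 :> R by rewrite gt_eqF.
  have r00 : m ^ (2 * rn m n) != 0 by rewrite expfz_neq0.
  have m10 : m - 1 != 0 by rewrite subr_eq0 gt_eqF.
  move: (m ^ (2 * rn m n)) (m ^ u) n%:R (m - 1) r00 n00 m10 => x y z w h1 h2 h3.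
  by clear -h1 h2 h3; field; rewrite ?h1 ?h2 ?h3.
have -> : (fun w => expR (- (m ^ (u + 1) * W w * W' w / ((m - 1) * chi m n ^+ 2)))) =
    (fun w => expR (- (c * W w * W' w))).
  by apply/funext => w; rewrite cE; congr expR; ring.
rewrite (expectation_product_laplace V0 c0) //; last 2 first.
- by move=> A mA; rewrite lW // lV.
- by move=> A mA; rewrite lW' // lV.
rewrite eE kE -EFinB abse_EFin lee_fin.
rewrite (_ : k.+1%:~R = k.+1%:R :> R) //.
set g := gnp_prob _ _ in he *.
rewrite -(mulrA (360 * _ * _)) -(mulrA (360 * _ * _)) -(mulrA (360 * _ * _)).
have K1 : 1 <= kap ^+ 6 * m ^+ 4 by rewrite mulr_ege1 // exprn_ege1 // ltW.
have [nu|un] := ltP n%:R (m ^ u).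
  have p01 : 0 <= m / n%:R <= 1.
    by rewrite divr_ge0 ?(ltW m0) ?(ltW nR) //= ler_pdivrMr // mul1r; lra.
  have g01 := gnp_prob01 k.+1 n0 p01; rewrite -/g in g01.
  apply: (@le_trans _ _ 1).
    exact: dist01_le1.
  have h := trivial_bound m1 L1 n0 nu.
  by rewrite mulr_ege1 // -mulrA mulr_ege1 // ler1n.
have nU := expr_rn_le m1 n0.
have U0 : 0 < m ^ u by rewrite exprz_gt0.
have mkn : m ^+ k.+1 <= n%:R * m ^ u by rewrite mk ler_wpM2r // ltW.
have MU : (m ^+ b) ^+ 2 <= n%:R * m ^ u.
  apply: le_trans mkn; rewrite -exprM muln2; apply: ler_weXn2l => //; exact: ltW.
(* In the remaining case m^u <= n, so m^(k + 1) <= n m^u <= n^2, and b <= k. *)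
have bL : b.+1%:R <= 2 * kap * ln n%:R.
  have lk : k.+1%:R * ln m <= 2 * ln n%:R.
    rewrite mulrC mulr_natr -lnXn // (_ : 2 * _ = ln (n%:R * n%:R)); last first.
      by rewrite lnM ?posrE //; ring.
    rewrite ler_ln ?posrE ?exprn_gt0 ?mulr_gt0 //.
    by apply: le_trans mkn _; rewrite ler_wpM2l // ltW.
  have h1 := ln_ge_inv m1; rewrite -/kap in h1.
  have h2 := ler_wpM2l k0 lk; have bk : b.+1%:R <= k.+1%:R :> R.
    by rewrite ler_nat ltnS /b leq_half_double -addnn; apply: leqW; exact: leq_addr.
  have h3 : k.+1%:R <= k.+1%:R * (kap * ln m) by rewrite ler_peMr.
  apply: (le_trans bk); apply: (le_trans h3); rewrite [leLHS]mulrCA (mulrC 2 kap) -[leRHS]mulrA.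
  exact: h2.
have := error_le m1 L1 n0 MU bL; rewrite -/kap; set Z := _ * ln _ => hZ.
have c120 : 0 <= 120 * kap ^+ 5 * m ^+ 4.
  apply: mulr_ge0; last by apply: exprn_ge0; exact: ltW.
  by apply: mulr_ge0 => //; exact: exprn_ge0.
apply: le_trans he _; apply: le_trans (ler_wpM2l c120 hZ) _.
by rewrite le_eqVlt; apply/orP; left; apply/eqP; rewrite /Z; ring.
Qed.
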